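(* If $H$ is a diffeologically discrete normal subgroup of an elastic diffeological group $G$, then $H$ and $G/H$ are elastic and $\mathrm{Lie}(G/H)\cong\mathrm{Lie}(G)$ as Lie algebras.
   Context: $H$ carries the subspace diffeology, $G/H$ the quotient diffeology. ''Diffeologically discrete'' means that every plot of $H$ is locally constant. A diffeological group is a group with a diffeology making multiplication and inversion smooth. An induction is an injective smooth map that is a diffeomorphism onto its image with the subspace diffeology. Tangent functor: for a functor $\hat F$ from the category of open subsets of Euclidean spaces (with smooth maps) to itself, $(\mathbb{L}\hat F)X$ is the quotient (with quotient diffeology) of $\coprod_{p\colon U\to X\text{ plot}}\hat FU$ by the equivalence relation generated by $(p,u)\sim(p',\hat Ff(u))$ whenever $f\colon U\to U'$ is smooth with $p=p'\circ f$; the class of $(p,u)$ is $p_*u$. A natural transformation $\hat\alpha$ induces $(\mathbb{L}\hat\alpha)_X(p_*u)=p_*(\hat\alpha_U(u))$. Let $\hat TU=U\times\mathbb{R}^n$ for $U\subseteq\mathbb{R}^n$, $\hat Tf(u,v)=(f(u),D_uf(v))$, $T=\mathbb{L}\hat T$, so $Tf(p_*(u,v))=(f\circ p)_*(u,v)$; $\pi_X(p_*(u,v))=p(u)$, $0_X(p(u))=p_*(u,0)$, $t\cdot p_*(u,v)=p_*(u,tv)$, $T_xX=\pi_X^{-1}(x)$, $T_kX=TX\times_X\cdots\times_XTX$ ($k$ factors). Elasticity: let $\hat T_kU=U\times(\mathbb{R}^n)^k$, $\hat T^2U=U\times(\mathbb{R}^n)^3$, $\hat\tau(u,v_0,v_1,v_{01})=(u,v_1,v_0,v_{01})$,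 $\hat\lambda(u,v)=(u,0,0,v)$, $\hat+(u,v_0,v_1)=(u,v_0+v_1)$. Natural maps: $\theta_{k,X}\colon(\mathbb{L}\hat T_k)X\to T_kX$, $p_*(u,v_0,\dots,v_{k-1})\mapsto(p_*(u,v_0),\dots,p_*(u,v_{k-1}))$; $\theta^2_X\colon(\mathbb{L}\hat T^2)X\to T^2X$, $p_*(u,v_0,v_1,v_{01})\mapsto T^2p(u,v_0,v_1,v_{01})$; $\nu_{k,X}\colon T(T_kX)\to T^2X\times_{TX}\cdots\times_{TX}T^2X$ (along $T\pi_X$), $(p_1,\dots,p_k)_*v\mapsto((p_1)_*v,\dots,(p_k)_*v)$. $X$ is elastic if: (E1) $\theta_{k,X}$ is an isomorphism for all $k\ge1$; (E2) there is a smooth $\tau_X\colon T^2X\to T^2X$ with $\tau_X\circ\theta^2_X=\theta^2_X\circ(\mathbb{L}\hat\tau)_X$; (E3) $\lambda_X:=\theta^2_X\circ(\mathbb{L}\hat\lambda)_X\colon TX\to T^2X$ is an induction; (E4) $\nu_{k,X}$ is injective for all $k\ge1$; (E5) all $T_{k_1}\cdots T_{k_n}X$ satisfy (E1)–(E4). A diffeological group is elastic if its underlying space is. Lie functor: on elastic $X$, fiberwise addition on $TX$ is $+=(\mathbb{L}\hat+)_X\circ\theta_{2,X}^{-1}$ (by a theorem of Blohmann, elastic spaces with this data form a tangent category). For vector fields $v,w$ (smooth sections of $\pi_X$), $\delta(v,w)=Tw\circ v-\tau_X\circ Tv\circ w$ (difference in fibers of $\pi_{TX}\colon T^2X\to TX$),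 $\lambda_2(a,b)=\tau_X(T0_X(a)+\lambda_X(b))$ for $(a,b)\in T_2X$, and $[v,w]$ is the unique vector field with $\delta(v,w)=\lambda_2\circ(w,[v,w])$. For an elastic group $G$ with unit $e$, $\mathrm{Lie}(G)=T_eG$ with the bracket of left-invariant vector fields transported by $v\mapsto v(e)$. *)

(* Defs.v *)
(* MathComp-Analysis.  Diffeological spaces, the left Kan extended tangent    *)
(* functor, elastic spaces, and the Lie algebra of an elastic group.          *)
(*                                                                            *)
(* Convention: a map defined on an open set U of R^n is represented by a      *)
(* total function on 'rV_n together with U; every notion below depends only   *)
(* on its values on U (and distinct total representatives of a plot become    *)
(* identified in the coproducts modulo kan_rel, by the morphism id).  On the  *)
(* empty space this omits the plots with empty domain, which carry no point.  *)

From HB Require Import structures.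
From mathcomp Require Import all_boot all_order all_algebra.
From Stdlib Require Import Relation_Operators.
From mathcomp Require Import generic_quotient.
From mathcomp Require Import all_classical all_reals all_analysis.
Set Implicit Arguments. Unset Strict Implicit. Unset Printing Implicit Defensive.
Import Order.TTheory GRing.Theory Num.Theory numFieldNormedType.Exports.
Local Open Scope classical_set_scope.
Local Open Scope ring_scope.
Local Open Scope quotient_scope.

Section Smooth.
Context {R : realType}.

Definition iterD (V W : normedModType R) (s : seq V) (f : V -> W) : V -> W :=
  foldr (fun v g => 'D_v g) f s.

(* C^infinity on U (for U open): all iterated directional derivatives exist
   and are differentiable at every point of U. *)
Definition smooth_on (V W : normedModType R) (U : set V) (f : V -> W) : Prop :=
  forall (s : seq V) (x : V), U x -> differentiable (iterD s f) x.

Lemma near_eq_differentiable (V W : normedModType R) (f g : V -> W) (x : V) :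
  (\near x, f x = g x) -> differentiable f x -> differentiable g x.
Proof.
move=> fg df; have fgx : f x = g x := nbhs_singleton fg.
have E : g \o shift x = cst (g x) + 'd f x +o_ 0 id.
  apply/eqaddoP => _/posnumP[e].
  have /eqaddoP /(_ e%:num (gt0 e)) := diff_locally df.
  have fg0 : \forall y \near (0 : V), f (y + x) = g (y + x).
    have cx : (fun y : V => y + x) @ (0 : V) --> x.
      rewrite -[X in _ --> X]add0r.
      by apply: cvgD; [exact: cvg_id|exact: cvg_cst].
    exact: cx _ fg.
  apply: filterS2 fg0 => y /= E.
  by rewrite !fctE /= E fgx.
have D := diff_unique (diff_continuous df) E.
by apply/diff_locallyP; rewrite D; split=> //; exact: diff_continuous.
Unshelve. all: by end_near. Qed.

Lemma iterD_rcons (V W : normedModType R) s v (f : V -> W) :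
  iterD (rcons s v) f = iterD s ('D_v f).
Proof. by rewrite /iterD foldr_rcons. Qed.

Definition smooth_upto (k : nat) (V W : normedModType R) (U : set V) (f : V -> W) :=
  forall (s : seq V) (x : V), (size s <= k)%N -> U x ->
    differentiable (iterD s f) x.

Lemma smooth_upto_smooth (V W : normedModType R) (U : set V) (f : V -> W) :
  (forall k, smooth_upto k U f) <-> smooth_on U f.
Proof. by split=> [h s x|h k s x _]; [apply: (h (size s))|apply: h]. Qed.

Lemma smooth_uptoS k (V W : normedModType R) (U : set V) (f : V -> W) :
  smooth_upto k.+1 U f <-> smooth_upto 0 U f /\ forall v, smooth_upto k U ('D_v f).
Proof.
split=> [h|[h0 h] s x].
  split=> [[|//] x _|v s x sk]; first exact: (h [::]).
  by rewrite -iterD_rcons; apply: h; rewrite size_rcons.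
elim/last_ind: s => [|s v _]; first by move=> _; exact: (h0 [::]).
by rewrite size_rcons iterD_rcons; apply: h.
Qed.

Lemma smooth_uptoW k (V W : normedModType R) (U : set V) (f : V -> W) :
  smooth_upto k.+1 U f -> smooth_upto k U f.
Proof. by move=> h s x sk; apply: h; exact: leqW. Qed.

Lemma smooth_upto0 k (V W : normedModType R) (U : set V) (f : V -> W) :
  smooth_upto k U f -> smooth_upto 0 U f.
Proof. by move=> h s x /leq_trans; move=> /(_ k)/(_ isT); exact: h. Qed.

Lemma iterD_near (V W : normedModType R) (U : set V) (f g : V -> W) s :
  open U -> (forall x, U x -> f x = g x) ->
  forall x, U x -> iterD s f x = iterD s g x.
Proof.
move=> oU fg; elim: s => [//|v s IH] x Ux; rewrite /iterD /=.
by apply: near_eq_derive; near=> y; apply: IH; near: y; exact: open_nbhs_nbhs.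
Unshelve. all: by end_near. Qed.

Lemma smooth_upto_ext k (V W : normedModType R) (U : set V) (f g : V -> W) :
  open U -> (forall x, U x -> f x = g x) -> smooth_upto k U f -> smooth_upto k U g.
Proof.
move=> oU fg h s x sk Ux; apply: near_eq_differentiable (h s x sk Ux).
near=> y; apply: (iterD_near s oU fg); near: y; exact: open_nbhs_nbhs.
Unshelve. all: by end_near. Qed.

Lemma smooth_upto_sub k (V W : normedModType R) (U U' : set V) (f : V -> W) :
  U' `<=` U -> smooth_upto k U f -> smooth_upto k U' f.
Proof. by move=> sU h s x sk /sU; exact: h. Qed.

Lemma smooth_upto_cst k (V W : normedModType R) (U : set V) (c : W) : smooth_upto k U (cst c).
Proof.
elim: k c => [|k IH] c.
  by move=> [|//] x _ _; exact: differentiable_cst.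
apply/smooth_uptoS; split; first by apply: smooth_upto0 (IH c).
move=> v; rewrite (_ : 'D_v (cst c) = cst 0) //.
by apply/funext => x; rewrite derive_cst.
Qed.

Lemma smooth_uptoD k (V W : normedModType R) (U : set V) (f g : V -> W) : open U ->
  smooth_upto k U f -> smooth_upto k U g -> smooth_upto k U (f + g).
Proof.
move=> oU; elim: k f g => [|k IH] f g hf hg.
  by move=> [|//] x _ Ux; apply: differentiableD; [exact: (hf [::])|exact: (hg [::])].
have [f0 f1] := (smooth_uptoS _ _ _).1 hf; have [g0 g1] := (smooth_uptoS _ _ _).1 hg.
apply/smooth_uptoS; split; first by apply: smooth_upto0 (IH _ _ (smooth_uptoW hf) (smooth_uptoW hg)).
move=> v; apply: smooth_upto_ext (IH _ _ (f1 v) (g1 v)) => // x Ux.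
by rewrite deriveD//; apply: diff_derivable; [exact: (f0 [::])|exact: (g0 [::])].
Qed.

Lemma smooth_upto_sum k (V W : normedModType R) (U : set V) n (f : 'I_n -> V -> W) :
  open U -> (forall i, smooth_upto k U (f i)) -> smooth_upto k U (fun x => \sum_i f i x).
Proof.
move=> oU; elim: n f => [|n IH] f h.
  apply: (@smooth_upto_ext k V W U (cst 0) _ oU) (smooth_upto_cst (k := k) (U := U) 0) => x _.
  by rewrite big_ord0.
apply: (smooth_upto_ext oU _ (smooth_uptoD oU (h ord0) (IH _ (fun i => h (lift ord0 i))))) => x _.
by rewrite fctE big_ord_recl.
Qed.

Lemma smooth_uptoM k (V : normedModType R) (U : set V) (f g : V -> R) : open U ->
  smooth_upto k U f -> smooth_upto k U g -> smooth_upto k U (f * g).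
Proof.
move=> oU; elim: k f g => [|k IH] f g hf hg.
  by move=> [|//] x _ Ux; apply: differentiableM; [exact: (hf [::])|exact: (hg [::])].
have [f0 f1] := (smooth_uptoS _ _ _).1 hf; have [g0 g1] := (smooth_uptoS _ _ _).1 hg.
apply/smooth_uptoS; split; first by apply: smooth_upto0 (IH _ _ (smooth_uptoW hf) (smooth_uptoW hg)).
move=> v.
apply: smooth_upto_ext (smooth_uptoD oU (IH _ _ (smooth_uptoW hf) (g1 v)) (IH _ _ (smooth_uptoW hg) (f1 v))) => // x Ux.
by rewrite deriveM//; apply: diff_derivable; [exact: (f0 [::])|exact: (g0 [::])].
Qed.

Lemma smooth_upto_lin k (V W W' : normedModType R) (U : set V) (f : V -> W)
  (L : {linear W -> W'}) : open U -> continuous L ->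
  smooth_upto k U f -> smooth_upto k U (L \o f).
Proof.
move=> oU cL; elim: k f => [|k IH] f hf.
  move=> [|//] x _ Ux; apply: differentiable_comp; first exact: (hf [::]).
  exact: linear_differentiable.
have [f0 f1] := (smooth_uptoS _ _ _).1 hf.
apply/smooth_uptoS; split; first by apply: smooth_upto0 (IH _ (smooth_uptoW hf)).
move=> v; apply: smooth_upto_ext (IH _ (f1 v)) => // x Ux.
have dfx : differentiable f x by exact: (f0 [::]).
have dL : differentiable L (f x) by exact: linear_differentiable.
rewrite deriveE; last exact: differentiable_comp.
by rewrite diff_comp// diff_lin//= deriveE.
Qed.

Lemma row_sum n (x : 'rV[R]_n) : x = \sum_i x 0 i *: delta_mx 0 i.
Proof. exact: row_sum_delta. Qed.

Lemma smooth_upto_scl k (V W : normedModType R) (U : set V) (f : V -> R) (w : W) : open U ->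
  smooth_upto k U f -> smooth_upto k U (fun x => f x *: w).
Proof.
move=> oU; elim: k f => [|k IH] f hf.
  by move=> [|//] x _ Ux; apply: differentiableZl; exact: (hf [::]).
have [f0 f1] := (smooth_uptoS _ _ _).1 hf.
apply/smooth_uptoS; split; first by apply: smooth_upto0 (IH _ (smooth_uptoW hf)).
move=> v; apply: smooth_upto_ext (IH _ (f1 v)) => // x Ux.
have dfx : differentiable f x by exact: (f0 [::]).
by rewrite [RHS]deriveE; [rewrite diffZl// deriveE|exact: differentiableZl].
Qed.

Lemma smooth_upto_coordP k (V : normedModType R) (U : set V) n (f : V -> 'rV[R]_n) :
  open U -> smooth_upto k U f <-> forall j, smooth_upto k U (fun x => f x 0 j : R).
Proof.
move=> oU; split=> [h j|h].
  have lC : linear (fun N : 'rV[R]_n => N 0 j : R).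
    by move=> a u v; rewrite !mxE.
  pose mC := GRing.isLinear.Build _ _ _ _ _ lC.
  pose C : {linear 'rV[R]_n -> R} := HB.pack (fun N : 'rV[R]_n => N 0 j : R) mC.
  by apply: (@smooth_upto_lin k V _ _ U f C) => //; exact: coord_continuous.
apply: (smooth_upto_ext oU _ (smooth_upto_sum oU (fun j => smooth_upto_scl (delta_mx 0 j) oU (h j)))) => x _.
by rewrite -row_sum.
Qed.

Lemma smooth_upto_comp k (V : normedModType R) m n (U : set V) (U' : set 'rV[R]_m)
  (f : V -> 'rV[R]_m) (g : 'rV[R]_m -> 'rV[R]_n) :
  open U -> open U' -> (forall x, U x -> U' (f x)) ->
  smooth_upto k U f -> smooth_upto k U' g -> smooth_upto k U (g \o f).
Proof.
move=> oU oU' fU hf /(smooth_upto_coordP _ _ oU') hg.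
apply/(smooth_upto_coordP _ _ oU) => j; move: {hg}(hg j).
rewrite -[fun x => (g \o f) x 0 j]/((fun y => g y 0 j : R) \o f).
move: (fun y => _) => {}g.
elim: k f g hf fU => [|k IH] f g hf fU hg.
  move=> [|//] x _ Ux; apply: differentiable_comp; first exact: (hf [::]).
  by apply: (hg [::]) => //; exact: fU.
have [f0 f1] := (smooth_uptoS _ _ _).1 hf; have [g0 g1] := (smooth_uptoS _ _ _).1 hg.
apply/smooth_uptoS; split; first by apply: smooth_upto0 (IH _ _ (smooth_uptoW hf) fU (smooth_uptoW hg)).
move=> v.
have H i : smooth_upto k U ((fun x => 'D_v f x 0 i : R) * ('D_(delta_mx 0 i) g \o f)).
  apply: smooth_uptoM => //; first by have /(smooth_upto_coordP _ _ oU) := f1 v; apply.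
  by apply: IH => //; exact: smooth_uptoW.
apply: (smooth_upto_ext oU _ (smooth_upto_sum oU H)) => x Ux.
have dfx : differentiable f x by exact: (f0 [::]).
have dg : differentiable g (f x) by apply: (g0 [::]) => //; exact: fU.
rewrite (deriveE _ (differentiable_comp dfx dg)) diff_comp//=.
rewrite -[in RHS](deriveE _ dfx) [in RHS](row_sum ('D_v f x)) linear_sum.
by apply: eq_bigr => i _; rewrite linearZ /= -(deriveE _ dg) fctE.
Qed.

Lemma smooth_on_comp (V : normedModType R) m n (U : set V) (U' : set 'rV[R]_m)
  (f : V -> 'rV[R]_m) (g : 'rV[R]_m -> 'rV[R]_n) :
  open U -> open U' -> (forall x, U x -> U' (f x)) ->
  smooth_on U f -> smooth_on U' g -> smooth_on U (g \o f).
Proof.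
move=> oU oU' fU /smooth_upto_smooth hf /smooth_upto_smooth hg; apply/smooth_upto_smooth => k.
exact: smooth_upto_comp (hf k) (hg k).
Qed.

Lemma smooth_on_cst (V W : normedModType R) (U : set V) (c : W) :
  smooth_on U (fun=> c).
Proof. by apply/smooth_upto_smooth => k; exact: smooth_upto_cst. Qed.

Lemma smooth_on_lin (V W : normedModType R) (U : set V) (L : {linear V -> W}) :
  continuous L -> smooth_on U L.
Proof.
move=> cL s x _; elim/last_ind: s => [|s v _]; first exact: linear_differentiable.
rewrite iterD_rcons (_ : 'D_v L = cst (L v)).
  exact: (smooth_on_cst (U := setT) (L v)).
by apply/funext => y; rewrite deriveE ?diff_lin//; exact: linear_differentiable.
Qed.

Lemma smooth_on_eq (V W : normedModType R) (U : set V) (f g : V -> W) :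
  open U -> (forall x, U x -> f x = g x) -> smooth_on U f -> smooth_on U g.
Proof.
by move=> oU fg /smooth_upto_smooth hf; apply/smooth_upto_smooth => k; exact: smooth_upto_ext (hf k).
Qed.

Lemma smooth_on_coordP (V : normedModType R) (U : set V) n (f : V -> 'rV[R]_n) :
  open U -> smooth_on U f <-> forall j, smooth_on U (fun x => f x 0 j : R).
Proof.
move=> oU; split=> [/smooth_upto_smooth h j|h]; apply/smooth_upto_smooth => k.
  by have /(smooth_upto_coordP _ _ oU) := h k; apply.
by apply/(smooth_upto_coordP _ _ oU) => j; exact: (smooth_upto_smooth _ _).2 k.
Qed.

Lemma open_smooth_preimage (V W : normedModType R) (U : set V) (f : V -> W)
  (U' : set W) : open U -> smooth_on U f -> open U' -> open (U `&` f @^-1` U').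
Proof.
rewrite !openE => oU sf oU' x [Ux U'fx]; apply: filterI; first exact: oU.
by apply: (differentiable_continuous (sf [::] x Ux)); exact: oU'.
Qed.

End Smooth.

HB.mixin Record isDiffeological (R : realType) (T : Type) := {
  plot : forall n, set 'rV[R]_n -> ('rV[R]_n -> T) -> Prop;
  plot_open : forall n (U : set 'rV[R]_n) p, @plot n U p -> open U;
  plot_cst : forall n (U : set 'rV[R]_n) (x : T), open U -> @plot n U (fun=> x);
  plot_local : forall n (U : set 'rV[R]_n) p, open U ->
    (forall u, U u -> exists (V : set 'rV[R]_n) q,
       [/\ V u, V `<=` U, @plot n V q & forall x, V x -> p x = q x]) ->
    @plot n U p;
  plot_comp : forall m n (U : set 'rV[R]_n) (V : set 'rV[R]_m) p
      (f : 'rV[R]_m -> 'rV[R]_n), @plot n U p -> open V -> smooth_on V f -> (forall x, V x -> U (f x)) ->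
    @plot m V (p \o f)
}.

#[short(type="diffeologicalType")]
HB.structure Definition Diffeological (R : realType) :=
  {T of isDiffeological R T}.

Arguments plot {R s n} U p.
Arguments plot_open {R s n U p}.
Arguments plot_cst {R s n U} x.
Arguments plot_local {R s n U p}.
Arguments plot_comp {R s m n U V p f}.

Definition smooth (R : realType) (X Y : diffeologicalType R) (f : X -> Y) :=
  forall n (U : set 'rV[R]_n) (p : 'rV[R]_n -> X), plot U p -> plot U (f \o p).

Record smoothMap (R : realType) (X Y : diffeologicalType R) := SmoothMap {
  smooth_fun :> X -> Y;
  smooth_funP : smooth smooth_fun }.

Section Constructions.
Context {R : realType}.
Implicit Types X Y : diffeologicalType R.

Lemma plot_eq X n (U : set 'rV[R]_n) (p q : 'rV[R]_n -> X) :
  (forall x, U x -> p x = q x) -> plot U p -> plot U q.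
Proof.
move=> pq hp; apply: plot_local (plot_open hp) _ => u Uu; exists U, p; split=> //.
by move=> x /pq.
Qed.

Lemma plot_sub X n (U V : set 'rV[R]_n) (p : 'rV[R]_n -> X) :
  open V -> V `<=` U -> plot U p -> plot V p.
Proof.
move=> oV VU hp; apply: (plot_comp (f := id) hp oV _ VU).
exact: (@smooth_on_lin R _ _ V idfun (fun x => cvg_id)).
Qed.

Definition eucl n : Type := 'rV[R]_n.

Let eucl_plot m (n : nat) (U : set 'rV[R]_n) (p : 'rV[R]_n -> eucl m) :=
  open U /\ smooth_on U (p : 'rV[R]_n -> 'rV[R]_m).

Let eucl_open m n U p : @eucl_plot m n U p -> open U. Proof. by case. Qed.
Let eucl_cst m n U x : open U -> @eucl_plot m n U (fun=> x).
Proof. by move=> oU; split => //; exact: smooth_on_cst. Qed.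
Let eucl_local m n U p :
    open U -> (forall u, U u -> exists (V : set 'rV[R]_n) q, [/\ V u, V `<=` U, @eucl_plot m n V q &
                                      forall x, V x -> p x = q x]) ->
    @eucl_plot m n U p.
Proof.
move=> oU h; split=> // s x /h[V [q [Vx _ [oV sq] pq]]].
by apply: (smooth_on_eq oV _ sq) => // y /pq.
Qed.
Let eucl_comp m n1 n U V p (f : 'rV[R]_n1 -> 'rV[R]_n) : @eucl_plot m n U p ->
    open V -> smooth_on V f -> (forall x, V x -> U (f x)) ->
    @eucl_plot m n1 V (p \o f).
Proof. by case=> oU sp oV sf fV; split=> //; exact: smooth_on_comp sf sp. Qed.

HB.instance Definition _ m := isDiffeological.Build R (eucl m)
  (@eucl_open m) (@eucl_cst m) (@eucl_local m) (@eucl_comp m).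

Section Sub.
Variables (X : diffeologicalType R) (A : set X).

Let sub_plot (n : nat) (U : set 'rV[R]_n) (p : 'rV[R]_n -> set_type A) :=
  plot U (fun x => val (p x)).
Let sub_open n U p : @sub_plot n U p -> open U. Proof. exact: plot_open. Qed.
Let sub_cst n U x : open U -> @sub_plot n U (fun=> x).
Proof. exact: plot_cst. Qed.
Let sub_local n U p :
    open U -> (forall u, U u -> exists (V : set 'rV[R]_n) q, [/\ V u, V `<=` U, @sub_plot n V q &
                                      forall x, V x -> p x = q x]) ->
    @sub_plot n U p.
Proof.
move=> oU h; apply: plot_local oU _ => u /h[V [q [Vu VU sq pq]]].
by exists V, (fun x => val (q x)); split=> // x /pq ->.
Qed.
Let sub_comp m n U V p (f : 'rV[R]_m -> 'rV[R]_n) : @sub_plot n U p ->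
    open V -> smooth_on V f -> (forall x, V x -> U (f x)) ->
    @sub_plot m V (p \o f).
Proof. by move=> hp oV sf fV; exact: (plot_comp hp oV sf fV). Qed.

HB.instance Definition _ := isDiffeological.Build R (set_type A)
  sub_open sub_cst sub_local sub_comp.
End Sub.

Section Coprod.
Variables (I : Type) (X : I -> diffeologicalType R).

Let coprod_plot n (U : set 'rV[R]_n) (p : 'rV[R]_n -> {i : I & X i}) :=
  open U /\ forall u, U u -> exists V i (q : 'rV[R]_n -> X i),
    [/\ V u, V `<=` U, plot V q & forall x, V x -> p x = existT _ i (q x)].
Let coprod_open n U p : @coprod_plot n U p -> open U. Proof. by case. Qed.
Let coprod_cst n U x : open U -> @coprod_plot n U (fun=> x).
Proof.
move=> oU; split=> // u Uu; case: x => i x.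
by exists U, i, (fun=> x); split=> //; exact: plot_cst.
Qed.
Let coprod_local n U p :
    open U -> (forall u, U u -> exists (V : set 'rV[R]_n) q, [/\ V u, V `<=` U, @coprod_plot n V q &
                                      forall x, V x -> p x = q x]) ->
    @coprod_plot n U p.
Proof.
move=> oU h; split=> // u /h[V [q [Vu VU [_ /(_ _ Vu)]]]].
move=> [W [i [r [Wu WV hr qr]]]] pq; exists W, i, r; split=> //.
  exact: subset_trans VU.
by move=> x Wx; rewrite pq ?qr//; exact: WV.
Qed.
Let coprod_comp m n U V p (f : 'rV[R]_m -> 'rV[R]_n) : @coprod_plot n U p ->
    open V -> smooth_on V f -> (forall x, V x -> U (f x)) ->
    @coprod_plot m V (p \o f).
Proof.
move=> [oU hp] oV sf fV; split=> // v Vv.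
have [W [i [q [Wu WU hq pq]]]] := hp _ (fV _ Vv).
exists (V `&` f @^-1` W), i, (q \o f);
  split; [by []|by move=> x []| |by move=> x [_ /pq]].
apply: (plot_comp hq _ _ (fun x : 'rV[R]_m => @proj2 _ _)).
  by apply: open_smooth_preimage => //; exact: plot_open hq.
by move=> s x [Vx _]; exact: sf.
Qed.

HB.instance Definition _ := isDiffeological.Build R {i : I & X i}
  coprod_open coprod_cst coprod_local coprod_comp.
End Coprod.

Section Prod.
Variables X Y : diffeologicalType R.

Let prod_plot n (U : set 'rV[R]_n) (p : 'rV[R]_n -> X * Y) :=
  plot U (fun x => (p x).1) /\ plot U (fun x => (p x).2).
Let prod_open n U p : @prod_plot n U p -> open U.
Proof. by case=> /plot_open. Qed.
Let prod_cst n U x : open U -> @prod_plot n U (fun=> x).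
Proof. by split; exact: plot_cst. Qed.
Let prod_local n U p :
    open U -> (forall u, U u -> exists (V : set 'rV[R]_n) q, [/\ V u, V `<=` U, @prod_plot n V q &
                                      forall x, V x -> p x = q x]) ->
    @prod_plot n U p.
Proof.
move=> oU h; split; apply: plot_local oU _ => u /h[V [q [Vu VU [s1 s2] pq]]].
  by exists V, (fun x => (q x).1); split=> // x /pq ->.
by exists V, (fun x => (q x).2); split=> // x /pq ->.
Qed.
Let prod_comp m n U V p (f : 'rV[R]_m -> 'rV[R]_n) : @prod_plot n U p ->
    open V -> smooth_on V f -> (forall x, V x -> U (f x)) ->
    @prod_plot m V (p \o f).
Proof.
move=> [h1 h2] oV sf fV.
by split; [exact: (plot_comp h1 oV sf fV)|exact: (plot_comp h2 oV sf fV)].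
Qed.

HB.instance Definition _ := isDiffeological.Build R (X * Y)%type
  prod_open prod_cst prod_local prod_comp.
End Prod.

Section Pow.
Variables (k : nat) (X : diffeologicalType R).

Definition dpow : Type := 'I_k -> X.

Let pow_plot n (U : set 'rV[R]_n) (p : 'rV[R]_n -> dpow) :=
  open U /\ forall i, plot U (fun x => p x i).
Let pow_open n U p : @pow_plot n U p -> open U. Proof. by case. Qed.
Let pow_cst n U x : open U -> @pow_plot n U (fun=> x).
Proof. by split=> // i; exact: plot_cst. Qed.
Let pow_local n U p :
    open U -> (forall u, U u -> exists (V : set 'rV[R]_n) q, [/\ V u, V `<=` U, @pow_plot n V q &
                                      forall x, V x -> p x = q x]) ->
    @pow_plot n U p.
Proof.
move=> oU h; split=> // i; apply: plot_local oU _ => u /h[V [q [Vu VU [_ hq] pq]]].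
by exists V, (fun x => q x i); split=> // x /pq ->.
Qed.
Let pow_comp m n U V p (f : 'rV[R]_m -> 'rV[R]_n) : @pow_plot n U p ->
    open V -> smooth_on V f -> (forall x, V x -> U (f x)) ->
    @pow_plot m V (p \o f).
Proof.
by move=> [_ h] oV sf fV; split=> // i; exact: (plot_comp (h i) oV sf fV).
Qed.

HB.instance Definition _ := isDiffeological.Build R dpow
  pow_open pow_cst pow_local pow_comp.
End Pow.

(* quotient by the equivalence relation generated by r *)
Section Quot.
Variables (X : diffeologicalType R) (r : X -> X -> Prop).

Definition gen_rel : rel {classic X} :=
  fun x y => `[< clos_refl_sym_trans X r x y >].
Lemma gen_rel_refl : reflexive gen_rel.
Proof. by move=> x; apply/asboolP; exact: rst_refl. Qed.
Lemma gen_rel_sym : symmetric gen_rel.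
Proof. by move=> x y; apply/asboolP/asboolP; exact: rst_sym. Qed.
Lemma gen_rel_trans : transitive gen_rel.
Proof.
by move=> y x z /asboolP xy /asboolP yz; apply/asboolP; exact: rst_trans yz.
Qed.
Canonical gen_equiv := EquivRel gen_rel gen_rel_refl gen_rel_sym gen_rel_trans.

Definition dquot : Type := {eq_quot gen_equiv}.
Definition dpi (x : X) : dquot := \pi_{eq_quot gen_equiv} (x : {classic X}).
Definition drepr (z : dquot) : X := repr (z : {eq_quot gen_equiv}).

Lemma dreprK z : dpi (drepr z) = z. Proof. exact: reprK. Qed.
Lemma dpi_eq x y : dpi x = dpi y <-> clos_refl_sym_trans X r x y.
Proof.
split=> [/eqmodP/asboolP//|h].
by apply/eqmodP/asboolP.
Qed.

Let quot_plot n (U : set 'rV[R]_n) (p : 'rV[R]_n -> dquot) :=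
  open U /\ forall u, U u -> exists V (q : 'rV[R]_n -> X),
    [/\ V u, V `<=` U, plot V q & forall x, V x -> p x = dpi (q x)].
Let quot_open n U p : @quot_plot n U p -> open U. Proof. by case. Qed.
Let quot_cst n U x : open U -> @quot_plot n U (fun=> x).
Proof.
move=> oU; split=> // u Uu; exists U, (fun=> drepr x).
by split=> // *; [exact: plot_cst|rewrite dreprK].
Qed.
Let quot_local n U p :
    open U -> (forall u, U u -> exists (V : set 'rV[R]_n) q, [/\ V u, V `<=` U, @quot_plot n V q &
                                      forall x, V x -> p x = q x]) ->
    @quot_plot n U p.
Proof.
move=> oU h; split=> // u /h[V [q [Vu VU [_ /(_ _ Vu)]]]].
move=> [W [s [Wu WV hr qr]]] pq; exists W, s; split=> //.
  exact: subset_trans VU.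
by move=> x Wx; rewrite pq ?qr//; exact: WV.
Qed.
Let quot_comp m n U V p (f : 'rV[R]_m -> 'rV[R]_n) : @quot_plot n U p ->
    open V -> smooth_on V f -> (forall x, V x -> U (f x)) ->
    @quot_plot m V (p \o f).
Proof.
move=> [oU hp] oV sf fV; split=> // v Vv.
have [W [q [Wu WU hq pq]]] := hp _ (fV _ Vv).
exists (V `&` f @^-1` W), (q \o f);
  split; [by []|by move=> x []| |by move=> x [_ /pq]].
apply: (plot_comp hq _ _ (fun x : 'rV[R]_m => @proj2 _ _)).
  by apply: open_smooth_preimage => //; exact: plot_open hq.
by move=> s x [Vx _]; exact: sf.
Qed.

HB.instance Definition _ := isDiffeological.Build R dquot
  quot_open quot_cst quot_local quot_comp.
HB.instance Definition _ := Choice.on dquot.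

Lemma dlift_repr (Z : Type) (f : X -> Z) (x : X) :
  (forall x y, r x y -> f x = f y) -> f (drepr (dpi x)) = f x.
Proof.
move=> fr; have H a b : clos_refl_sym_trans X r a b -> f a = f b.
  by elim=> {a b} [|//|a b _ ->//|a b c _ -> _ ->//]; exact: fr.
by apply: H; apply/dpi_eq; exact: dreprK.
Qed.
End Quot.

End Constructions.

Section Kan.
Context {R : realType}.
Implicit Types X Y : diffeologicalType R.

(* The data of an endofunctor of open sets of Euclidean spaces in which the
   dimension of F U depends only on that of U; this is all that the Kan
   extension uses.  fmor is only meaningful on fobj U for f smooth on U. *)
Record efunctor := EFunctor {
  fdim : nat -> nat;
  fobj : forall n, set 'rV[R]_n -> set 'rV[R]_(fdim n);
  fmor : forall m n, ('rV[R]_m -> 'rV[R]_n) ->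
                     'rV[R]_(fdim m) -> 'rV[R]_(fdim n) }.
Arguments fobj _ {n} U.
Arguments fmor _ {m n} f w.

(* The components of a natural transformation; see natural below. *)
Record enat (F F' : efunctor) := ENat {
  ecomp : forall n, 'rV[R]_(fdim F n) -> 'rV[R]_(fdim F' n);
  ecompP : forall n (U : set 'rV[R]_n) w, fobj F U w -> fobj F' U (ecomp w) }.
Arguments ecomp {F F'} _ {n} w.
Arguments ecompP {F F'} _ {n U w}.

(* A plot together with its domain. *)
Record parametrization X := Plot {
  pdim : nat;
  pdom : set 'rV[R]_pdim;
  pfun :> 'rV[R]_pdim -> X;
  pplot : plot pdom pfun }.
Arguments pdim {X} p.
Arguments pdom {X} p.
Arguments pfun {X} p.
Arguments pplot {X} p.

Section KanDef.
Variables (F : efunctor) (X : diffeologicalType R).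

Definition kan_fiber (p : parametrization X) : diffeologicalType R :=
  set_type (fobj F (pdom p) : set (eucl (fdim F (pdim p)))).

Definition kan_sum : diffeologicalType R :=
  {p : parametrization X & kan_fiber p}.

Definition kan_rel (a b : kan_sum) : Prop :=
  exists f : 'rV[R]_(pdim (projT1 a)) -> 'rV[R]_(pdim (projT1 b)),
    [/\ smooth_on (pdom (projT1 a)) f,
        forall x, pdom (projT1 a) x -> pdom (projT1 b) (f x),
        forall x, pdom (projT1 a) x -> projT1 a x = projT1 b (f x) &
        val (projT2 b) = fmor F f (val (projT2 a))].

(* (L F) X *)
Definition kan : diffeologicalType R := dquot kan_rel.

(* the class p_* w *)
Definition kan_mk (p : parametrization X) w (hw : fobj F (pdom p) w) : kan :=
  dpi kan_rel (existT kan_fiber p (exist _ w (mem_set hw))).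

Lemma kan_sumP (a : kan_sum) : fobj F (pdom (projT1 a)) (val (projT2 a)).
Proof. exact: (set_mem (valP (projT2 a))). Qed.

Lemma kan_plot (p : parametrization X) n (U : set 'rV[R]_n)
    (g : 'rV[R]_n -> 'rV[R]_(fdim F (pdim p)))
    (hg : forall s, U s -> fobj F (pdom p) (g s)) (q : 'rV[R]_n -> kan) :
  open U -> smooth_on U g -> (forall s (Us : U s), q s = kan_mk (hg s Us)) ->
  plot U q.
Proof.
move=> oU sg qE; split=> // u Uu.
pose g' s : kan_fiber p := if pselect (U s) is left h
  then exist _ (g s) (mem_set (hg s h)) else exist _ (g u) (mem_set (hg u Uu)).
exists U, (fun s => existT kan_fiber p (g' s)); split=> //; last first.
  move=> s Us; rewrite (qE s Us) /g'; case: pselect => // h.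
  by rewrite (Prop_irrelevance h Us).
split=> // v Uv; exists U, p, g'; split=> //.
split=> //; apply: (smooth_on_eq oU _ sg) => s Us.
by rewrite /g'; case: pselect.
Qed.

End KanDef.

Lemma kan_push_plot X Y (f : smoothMap X Y) (p : parametrization X) :
  plot (pdom p) (f \o p).
Proof. exact/smooth_funP/pplot. Qed.

Definition kan_map F X Y (f : smoothMap X Y) (z : kan F X) : kan F Y :=
  let a := drepr z in
  @kan_mk F Y (Plot (kan_push_plot f (projT1 a))) _ (kan_sumP a).

Lemma kan_mapE F X Y (f : smoothMap X Y) (p : parametrization X) w
    (hw : fobj F (pdom p) w) :
  kan_map f (kan_mk hw) = @kan_mk F Y (Plot (kan_push_plot f p)) w hw.
Proof.
pose h (a : kan_sum F X) :=
  @kan_mk F Y (Plot (kan_push_plot f (projT1 a))) _ (kan_sumP a).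
rewrite [LHS](@dlift_repr _ _ _ _ h) => [|a b [g [sg gU pg E]]].
  by rewrite /h /kan_mk; congr (dpi _ (existT _ _ _)); exact: val_inj.
apply/dpi_eq/rst_step; exists g; split=> // x px.
by rewrite /= pg.
Qed.

(* (L alpha)_X (p_* w) = p_* (alpha w).  It is evaluated on a chosen
   representative, which is immaterial when alpha is natural (kan_natE). *)
Definition kan_nat F F' (alpha : enat F F') X (z : kan F X) : kan F' X :=
  let a := drepr z in kan_mk (ecompP alpha (kan_sumP a)).

Definition natural F F' (alpha : enat F F') : Prop :=
  forall m n (U : set 'rV[R]_m) (V : set 'rV[R]_n) f w,
    open U -> open V -> smooth_on U f -> (forall x, U x -> V (f x)) ->
    fobj F U w -> fmor F' f (ecomp alpha w) = ecomp alpha (fmor F f w).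

Lemma kan_natE F F' (alpha : enat F F') X (p : parametrization X) w
    (hw : fobj F (pdom p) w) :
  natural alpha -> kan_nat alpha (kan_mk hw) = kan_mk (ecompP alpha hw).
Proof.
move=> nat; pose h (a : kan_sum F X) := kan_mk (ecompP alpha (kan_sumP a)).
rewrite [LHS](@dlift_repr _ _ _ _ h) => [|a b [g [sg gU pg E]]].
  by rewrite /h /kan_mk; congr (dpi _ (existT _ _ _)); exact: val_inj.
apply/dpi_eq/rst_step; exists g; split=> //=.
have oa := plot_open (pplot (projT1 a)); have ob := plot_open (pplot (projT1 b)).
by rewrite E (nat _ _ _ _ _ _ oa ob sg gU)//; exact: (kan_sumP a).
Qed.

(* A point (u, v) of T U is row_mx u v. *)
Definition T_obj n (U : set 'rV[R]_n) : set 'rV[R]_(n + n) :=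
  [set w | U (lsubmx w)].
Definition T_mor m n (f : 'rV[R]_m -> 'rV[R]_n) (w : 'rV[R]_(m + m)) :
  'rV[R]_(n + n) := row_mx (f (lsubmx w)) ('d f (lsubmx w) (rsubmx w)).
Definition T_hat := EFunctor T_obj T_mor.

Lemma T_mor_id n (w : 'rV[R]_(n + n)) : T_mor id w = w.
Proof.
by rewrite /T_mor (diff_lin (f := idfun)) ?hsubmxK// => x; exact: cvg_id.
Qed.

(* T (T U): the point (u, v0, v1, v01) is row_mx (row_mx u v0) (row_mx v1 v01),
   where v1 and v01 are the components of the outer tangent vector. *)
Definition T2_hat := EFunctor (fun n (U : set 'rV[R]_n) => T_obj (T_obj U))
  (fun m n f => T_mor (T_mor f)).

(* The point (u, v_0, ..., v_(k-1)) of T_k U is row_mx u (mxvec A) where v_i is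
   the i-th row of A. *)
Definition vec_i k n (i : 'I_k) (w : 'rV[R]_(n + k * n)) : 'rV[R]_n :=
  row i (vec_mx (rsubmx w)).
Definition Tk_hat k := @EFunctor (fun n => n + k * n)%N
  (fun n U => [set w | U (lsubmx w)])
  (fun m n f w => row_mx (f (lsubmx w))
     (mxvec (\matrix_(i < k) 'd f (lsubmx w) (vec_i i w)))).

Definition tau_comp n (w : 'rV[R]_((n + n) + (n + n))) :=
  let u := lsubmx (lsubmx w) in let v0 := rsubmx (lsubmx w) in
  let v1 := lsubmx (rsubmx w) in let v01 := rsubmx (rsubmx w) in
  row_mx (row_mx u v1) (row_mx v0 v01).
Lemma tau_compP n (U : set 'rV[R]_n) w :
  fobj T2_hat U w -> fobj T2_hat U (tau_comp w).
Proof. by rewrite /= /T_obj /= !row_mxKl. Qed.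
Definition tau_hat := @ENat T2_hat T2_hat tau_comp tau_compP.

Definition lambda_comp n (w : 'rV[R]_(n + n)) : 'rV[R]_((n + n) + (n + n)) :=
  row_mx (row_mx (lsubmx w) 0) (row_mx 0 (rsubmx w)).
Lemma lambda_compP n (U : set 'rV[R]_n) w :
  fobj T_hat U w -> fobj T2_hat U (lambda_comp w).
Proof. by rewrite /= /T_obj /= !row_mxKl. Qed.
Definition lambda_hat := @ENat T_hat T2_hat lambda_comp lambda_compP.

Lemma keep_base k n (U : set 'rV[R]_n) (w : 'rV[R]_(n + k)) (v : 'rV[R]_n) :
  U (lsubmx w) -> T_obj U (row_mx (lsubmx w) v).
Proof. by rewrite /T_obj /= row_mxKl. Qed.

Definition plus_hat := @ENat (Tk_hat 2) T_hat
  (fun n w => row_mx (lsubmx w) (vec_i ord0 w + vec_i ord_max w))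
  (fun n U w => @keep_base _ _ U w _).
Definition proj_hat k (i : 'I_k) := @ENat (Tk_hat k) T_hat
  (fun n w => row_mx (lsubmx w) (vec_i i w))
  (fun n U w => @keep_base _ _ U w _).
Definition scale_hat (t : R) := @ENat T_hat T_hat
  (fun n w => row_mx (lsubmx w) (t *: rsubmx w))
  (fun n U w => @keep_base _ _ U w _).

Definition Tan := kan T_hat.

Definition tpi_fun X (z : Tan X) : X :=
  let a := drepr z in projT1 a (lsubmx (val (projT2 a))).

Lemma tpi_mk X (p : parametrization X) w (hw : fobj T_hat (pdom p) w) :
  tpi_fun (kan_mk hw) = p (lsubmx w).
Proof.
pose h (a : kan_sum T_hat X) := projT1 a (lsubmx (val (projT2 a))).
rewrite [LHS](@dlift_repr _ _ _ _ h) // => a b [g [sg gU pg E]].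
rewrite /h E /= row_mxKl; apply: pg; exact: (kan_sumP a).
Qed.

Lemma smooth_on_lsubmx m n (U : set 'rV[R]_(m + n)) :
  smooth_on U (lsubmx : 'rV[R]_(m + n) -> 'rV[R]_m).
Proof. by apply: smooth_on_lin; exact: continuous_lsubmx. Qed.

Lemma smooth_on_row0 m n (U : set 'rV[R]_m) : open U ->
  smooth_on U (fun s => row_mx s (0 : 'rV[R]_n)).
Proof.
move=> oU; apply/smooth_on_coordP => // j.
have sid : smooth_on U (id : 'rV[R]_m -> _).
  exact: (@smooth_on_lin R _ _ U idfun (fun x => cvg_id)).
case: (split_ordP j) => i ->.
  apply: smooth_on_eq (((smooth_on_coordP _ oU).1 sid) i) => // s _.
  by rewrite row_mxEl.
apply: smooth_on_eq (smooth_on_cst 0) => // s _.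
by rewrite row_mxEr mxE.
Qed.

Lemma tpi_smooth X : smooth (@tpi_fun X).
Proof.
move=> n U q hq; apply: (plot_local (plot_open hq)) => u Uu.
have [_ /(_ u Uu)[V [r [Vu VU [_ hr] qr]]]] := hq.
have [W [p [g [Wu WV [oW sg] rg]]]] := hr u Vu.
exists W, (fun s => p (lsubmx (val (g s)))); split=> //.
- exact: subset_trans VU.
- apply: (plot_comp (f := fun s => lsubmx (val (g s))) (pplot p) oW).
    apply: (@smooth_on_comp R _ _ _ W setT) => //; first exact: openT.
    exact: smooth_on_lsubmx.
  by move=> s _; exact: (set_mem (valP (g s))).
move=> s Ws /=; rewrite qr ?rg//; last exact: WV.
rewrite (_ : dpi _ _ = kan_mk (set_mem (valP (g s)))) ?tpi_mk//.
by congr (dpi _ (existT _ _ _)); exact: val_inj.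
Qed.
Definition tpi X : smoothMap (Tan X) X := SmoothMap (@tpi_smooth X).

Lemma point_plot X (x : X) : plot [set: 'rV[R]_0] (fun=> x).
Proof. by apply: plot_cst; exact: openT. Qed.
(* 0_X x is the class of the zero vector along the constant plot R^0 -> X. *)
Definition tzero_fun X (x : X) : Tan X :=
  @kan_mk T_hat X (Plot (point_plot x)) 0 I.

Lemma tzeroE X (p : parametrization X) u (hu : T_obj (pdom p) (row_mx u 0)) :
  tzero_fun (p u) = @kan_mk T_hat X p (row_mx u 0) hu.
Proof.
apply/dpi_eq/rst_step; exists (fun=> u); split=> //=.
- exact: smooth_on_cst.
- by move=> x _; move: hu; rewrite /T_obj /= row_mxKl.
- by rewrite /T_mor (diff_cst u).
Qed.

Lemma tzero_smooth X : smooth (@tzero_fun X).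
Proof.
move=> n U p hp; have oU := plot_open hp.
have hg s : U s -> fobj T_hat (pdom (Plot hp)) (row_mx s 0).
  by rewrite /= /T_obj /= row_mxKl.
apply: (@kan_plot T_hat X (Plot hp) n U (fun s => row_mx s 0) hg) => //.
  exact: smooth_on_row0.
by move=> s Us; rewrite -tzeroE.
Qed.
Definition tzero X : smoothMap X (Tan X) := SmoothMap (@tzero_smooth X).

Definition tscale X (t : R) : Tan X -> Tan X := kan_nat (scale_hat t) (X := X).

(* The k-fold fibre product of f along itself; only used for k > 0. *)
Definition fibprod k X Y (f : X -> Y) : diffeologicalType R :=
  set_type ([set x | forall i j, f (x i) = f (x j)] : set (dpow k X)).

Definition fib_mk k X Y (f : X -> Y) (x : dpow k X)
  (hx : forall i j, f (x i) = f (x j)) : fibprod k f := exist _ x (mem_set hx).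

Definition Tk k X := fibprod k (tpi X).

Definition Tk_proj_fun k X (i : 'I_k) (z : Tk k X) : Tan X := val z i.
Lemma Tk_proj_smooth k X i : smooth (@Tk_proj_fun k X i).
Proof. by move=> n U p [_]; exact. Qed.
Definition Tk_proj k {X} i := SmoothMap (@Tk_proj_smooth k X i).

Lemma tpi_kan_nat F (alpha : enat F T_hat) X (z : kan F X) :
  tpi X (kan_nat alpha z) =
  projT1 (drepr z) (lsubmx (ecomp alpha (val (projT2 (drepr z))))).
Proof. exact: tpi_mk. Qed.

Lemma theta_subproof k X (z : kan (Tk_hat k) X) (i j : 'I_k) :
  tpi X (kan_nat (proj_hat i) z) = tpi X (kan_nat (proj_hat j) z).
Proof. by rewrite !tpi_kan_nat /= !row_mxKl. Qed.
Definition theta k X (z : kan (Tk_hat k) X) : Tk k X :=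
  fib_mk (x := fun i => kan_nat (proj_hat i) z) (theta_subproof z).

(* For a plot p : U -> X, the plot T p : T U -> T X, w |-> p_* w.  The value
   outside of T U is irrelevant. *)
Definition T_plot_fun X (p : parametrization X) 
    (w : 'rV[R]_(pdim p + pdim p)) : Tan X :=
  if pselect (T_obj (pdom p) w) is left hw then @kan_mk T_hat X p w hw
  else tzero X (p (lsubmx w)).
Lemma T_plotP X (p : parametrization X) : plot (T_obj (pdom p)) (@T_plot_fun X p).
Proof.
apply: (@kan_plot T_hat X p _ _ id (fun s h => h)).
- have := continuous_lsubmx; have := plot_open (pplot p).
  move=> oU c; have /continuousP := @c R 1 (pdim p) (pdim p); exact.
- exact: (@smooth_on_lin R _ _ _ idfun (fun x => cvg_id)).
move=> s Us; rewrite /T_plot_fun; case: pselect => // h.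
by rewrite (Prop_irrelevance h Us).
Qed.
Definition T_plot X (p : parametrization X) := Plot (T_plotP p).

(* theta^2_X (p_* w) = (T^2 p) w = (T p)_* w *)
Definition theta2 X (z : kan T2_hat X) : Tan (Tan X) :=
  let a := drepr z in @kan_mk T_hat (Tan X) (T_plot (projT1 a)) _ (kan_sumP a).

Definition lambda X (z : Tan X) : Tan (Tan X) := theta2 (kan_nat lambda_hat z).

Lemma nu_subproof k X (z : Tan (Tk k X)) (i j : 'I_k) :
  kan_map (tpi X) (kan_map (Tk_proj i) z) = kan_map (tpi X) (kan_map (Tk_proj j) z).
Proof.
rewrite !kan_mapE; apply/dpi_eq/rst_step; exists id; split=> //=.
- exact: (@smooth_on_lin R _ _ _ idfun (fun x => cvg_id)).
- by move=> x _; have := set_mem (valP (projT1 (drepr z) x)) i j.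
by rewrite T_mor_id.
Qed.
Definition nu k X (z : Tan (Tk k X)) :
    fibprod k (kan_map (tpi X) : Tan (Tan X) -> Tan X) :=
  fib_mk (x := fun i => kan_map (Tk_proj i) z) (nu_subproof z).

End Kan.
Arguments fobj {R} _ {n} U.
Arguments fmor {R} _ {m n} f w.
Arguments ecomp {R F F'} _ {n} w.
Arguments ecompP {R F F'} _ {n U w}.
Arguments pdim {R X} p.
Arguments pdom {R X} p.
Arguments pfun {R X} p.
Arguments pplot {R X} p.

Section Elastic.
Context {R : realType}.
Implicit Types X Y : diffeologicalType R.

Definition diffeomorphism X Y (f : X -> Y) : Prop :=
  smooth f /\ exists g : Y -> X, [/\ smooth g, cancel f g & cancel g f].

Definition corestrict X Y (f : X -> Y) (x : X) : set_type (range f) :=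
  exist _ (f x) (mem_set (imageT f x)).

Definition is_induction X Y (f : X -> Y) : Prop :=
  [/\ injective f, smooth f & diffeomorphism (corestrict f)].

Definition elastic_E1 X : Prop :=
  forall k, (0 < k)%N -> diffeomorphism (@theta R k X).

(* tau o theta^2_X = theta^2_X o (L tau_hat)_X, evaluated on each class p_* w. *)
Definition is_tau X (tau : Tan (Tan X) -> Tan (Tan X)) : Prop :=
  smooth tau /\
  forall p w (hw : fobj T2_hat (pdom p) w),
    tau (theta2 (kan_mk hw)) = theta2 (kan_mk (ecompP tau_hat hw)).

Definition elastic_E2 X : Prop := exists tau, @is_tau X tau.
Definition elastic_E3 X : Prop := is_induction (@lambda R X).
Definition elastic_E4 X : Prop := forall k, (0 < k)%N -> injective (@nu R k X).

(* The spaces T_(k_1) ... T_(k_n) X with all k_i > 0.  T_1 X is T X; as Tk 1 X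
   is only isomorphic to Tan X (it consists of families indexed by 'I_1), both
   are included. *)
Inductive tangent_power X : diffeologicalType R -> Prop :=
| tangent_power0 : tangent_power X X
| tangent_powerT Y : tangent_power X Y -> tangent_power X (Tan Y)
| tangent_powerTk k Y : (0 < k)%N -> tangent_power X Y ->
    tangent_power X (Tk k Y).

Definition elastic X : Prop :=
  forall Y, tangent_power X Y ->
    [/\ elastic_E1 Y, elastic_E2 Y, elastic_E3 Y & elastic_E4 Y].

Lemma elastic_T X : elastic X -> elastic (Tan X).
Proof.
move=> h Y TY; apply: h; elim: TY => [|{}Y _|k {}Y k0 _].
- exact/tangent_powerT/tangent_power0.
- exact: tangent_powerT.
- exact: tangent_powerTk.
Qed.

Section TangentStructure.
Variables (X : diffeologicalType R) (EX : elastic X).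

Lemma elastic_has_E1 : elastic_E1 X.
Proof. by have [] := EX (tangent_power0 X). Qed.
Lemma elastic_has_E2 : elastic_E2 X.
Proof. by have [] := EX (tangent_power0 X). Qed.

Definition theta2_inv : Tk 2 X -> kan (Tk_hat 2) X :=
  sval (cid (elastic_has_E1 (isT : 0 < 2)%N).2).
Lemma theta2_invK : cancel theta2_inv (@theta R 2 X).
Proof. by rewrite /theta2_inv; case: cid => g []. Qed.

Definition tau : Tan (Tan X) -> Tan (Tan X) := sval (cid elastic_has_E2).
End TangentStructure.

Definition pair2 (Z : Type) (a b : Z) (i : 'I_2) : Z :=
  if i == ord0 then a else b.
Lemma pair2P X (a b : Tan X) : tpi X a = tpi X b ->
  forall i j, tpi X (pair2 a b i) = tpi X (pair2 a b j).
Proof. by move=> ab i j; rewrite /pair2; do 2!case: ifP. Qed.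

(* Fibrewise addition; the value on vectors in different fibres is irrelevant. *)
Definition tadd X (EX : elastic X) (a b : Tan X) : Tan X :=
  if pselect (tpi X a = tpi X b) is left ab
  then kan_nat plus_hat (theta2_inv EX (fib_mk (pair2P ab))) else a.

Lemma tpi_tadd X (EX : elastic X) a b : tpi X (tadd EX a b) = tpi X a.
Proof.
rewrite /tadd; case: pselect => // ab; set y := fib_mk _.
have <- : val y ord0 = a by [].
rewrite -[in RHS](theta2_invK EX y).
rewrite -[val (theta _) _]/(kan_nat (proj_hat ord0) _) !tpi_kan_nat /=.
by rewrite !row_mxKl.
Qed.

Lemma tpi_tscale X t (a : Tan X) : tpi X (tscale t a) = tpi X a.
Proof. by rewrite /tscale tpi_kan_nat /= row_mxKl. Qed.

Definition lambda2 X (EX : elastic X) (a b : Tan X) : Tan (Tan X) :=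
  tau EX (tadd (elastic_T EX) (kan_map (tzero X) a) (lambda b)).

Record vectorField X := VectorField {
  vf_map :> smoothMap X (Tan X);
  vf_section : forall x, tpi X (vf_map x) = x }.

Definition vf_delta X (EX : elastic X) (v w : vectorField X)
    (x : X) : Tan (Tan X) :=
  tadd (elastic_T EX) (kan_map w (v x))
    (tscale (-1) (tau EX (kan_map v (w x)))).

Lemma tpi_tzero X (x : X) : tpi X (tzero X x) = x.
Proof. exact: tpi_mk. Qed.
Definition vf_zero X : vectorField X := VectorField (@tpi_tzero X).

(* The unique u with delta (v, w) = lambda_2 o (w, u).  It exists on elastic
   spaces; the default vf_zero is only there to make the definition total. *)
Definition vf_bracket X (EX : elastic X) (v w : vectorField X) :
    vectorField X :=
  xget (vf_zero X : {classic vectorField X})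
    [set u : {classic vectorField X} |
      forall x, vf_delta EX v w x = lambda2 EX (w x) ((u : vectorField X) x)].

End Elastic.

HB.mixin Record isDiffeologicalGroup (R : realType) (G : Type)
    of Group G & Diffeological R G := {
  mulg_smooth : smooth (fun z : G * G => (z.1 * z.2)%g);
  invg_smooth : smooth (fun x : G => x^-1%g)
}.
#[short(type="diffeologicalGroupType")]
HB.structure Definition DiffeologicalGroup (R : realType) :=
  {G of Group G & Diffeological R G & isDiffeologicalGroup R G}.

Record normalSubgroup (G : groupType) := NormalSubgroup {
  nsub_set :> set G;
  nsub1 : nsub_set 1%g;
  nsubD : forall x y, nsub_set x -> nsub_set y -> nsub_set (x / y)%g;
  nsubJ : forall x g, nsub_set x -> nsub_set (x ^ g)%g }.

Section Quotient.
Context {R : realType} (G : diffeologicalGroupType R) (H : normalSubgroup G).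
Local Open Scope group_scope.

Definition coset_rel (x y : G) : Prop := nsub_set H (x^-1 * y).
Definition quotient_group : Type := dquot coset_rel.
HB.instance Definition _ := Diffeological.on quotient_group.
HB.instance Definition _ := Choice.on quotient_group.

Local Notation cl := (dpi coset_rel).

Lemma nsubV x : nsub_set H x -> nsub_set H x^-1.
Proof. by move=> Hx; rewrite -[_^-1]mul1g; exact: (nsubD (nsub1 H) Hx). Qed.
Lemma nsubM x y : nsub_set H x -> nsub_set H y -> nsub_set H (x * y).
Proof. by move=> Hx /nsubV Hy; rewrite -[y]invgK; exact: nsubD. Qed.

Lemma cosetP x y : cl x = cl y <-> coset_rel x y.
Proof.
split=> [/dpi_eq|h]; last exact/dpi_eq/rst_step.
rewrite /coset_rel; elim=> {x y} [//|x|x y _ xy|x y z _ xy _ yz].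
- by rewrite mulVg; exact: nsub1.
- by rewrite -[x in _ * x]invgK -invgM; exact: nsubV.
- by rewrite -[x^-1](mulgK y) -mulgA; exact: nsubM.
Qed.

Definition qmul (z t : quotient_group) : quotient_group :=
  cl (drepr (z : dquot coset_rel) * drepr (t : dquot coset_rel)).
Definition qinv (z : quotient_group) : quotient_group :=
  cl (drepr (z : dquot coset_rel))^-1.

Lemma coset_repr x : coset_rel (drepr (cl x)) x.
Proof. by apply/cosetP; exact: dreprK. Qed.

Lemma qmulE x y : qmul (cl x) (cl y) = cl (x * y).
Proof.
apply/cosetP; rewrite /coset_rel; set a := drepr _; set b := drepr _.
have ax : nsub_set H (a^-1 * x) := coset_repr x.
have by_ : nsub_set H (b^-1 * y) := coset_repr y.
have -> : (a * b)^-1 * (x * y) = (a^-1 * x) ^ b * (b^-1 * y).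
  by rewrite conjgE invgM !mulgA mulgK.
by apply: nsubM => //; exact: nsubJ.
Qed.
Lemma qinvE x : qinv (cl x) = cl x^-1.
Proof.
apply/cosetP; rewrite /coset_rel; set a := drepr _.
have ax : nsub_set H (a^-1 * x) := coset_repr x.
have -> : a^-1^-1 * x^-1 = ((a^-1 * x)^-1) ^ a^-1.
  by rewrite conjgE !invgM !invgK !mulgA mulgK.
by apply: nsubJ; exact: nsubV.
Qed.

Lemma coset_ind (P : quotient_group -> Prop) : (forall x, P (cl x)) -> forall z, P z.
Proof. by move=> h z; rewrite -[z](dreprK (r := coset_rel)). Qed.

Lemma qmulA : associative qmul.
Proof. by elim/coset_ind=> x; elim/coset_ind=> y; elim/coset_ind=> z; rewrite !qmulE mulgA. Qed.
Lemma qmul1 : left_id (cl 1) qmul.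
Proof. by elim/coset_ind=> x; rewrite qmulE mul1g. Qed.
Lemma q1mul : right_id (cl 1) qmul.
Proof. by elim/coset_ind=> x; rewrite qmulE mulg1. Qed.
Lemma qmulV : left_inverse (cl 1) qinv qmul.
Proof. by elim/coset_ind=> x; rewrite qinvE qmulE mulVg. Qed.
Lemma qmulgV : right_inverse (cl 1) qinv qmul.
Proof. by elim/coset_ind=> x; rewrite qinvE qmulE mulgV. Qed.

HB.instance Definition _ := isGroup.Build quotient_group
  qmulA qmul1 q1mul qmulV qmulgV.

Lemma qmul_smooth :
  smooth (fun z : quotient_group * quotient_group => (z.1 * z.2)).
Proof.
move=> n U p [[oU h1] [_ h2]]; split=> // u Uu.
have [V1 [q1 [V1u V1U pq1 e1]]] := h1 u Uu.
have [V2 [q2 [V2u V2U pq2 e2]]] := h2 u Uu.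
exists (V1 `&` V2), (fun x => q1 x * q2 x); split.
- by [].
- by move=> x [/V1U].
- apply: (@mulg_smooth R G n _ (fun x => (q1 x, q2 x))).
  have oV : open (V1 `&` V2).
    by apply: openI; [exact: plot_open pq1|exact: plot_open pq2].
  by split=> /=; [apply: plot_sub pq1|apply: plot_sub pq2] => // x [].
- move=> x [V1x V2x] /=; rewrite (e1 _ V1x) (e2 _ V2x); exact: qmulE.
Qed.

Lemma qinv_smooth : smooth (fun x : quotient_group => x^-1).
Proof.
move=> n U p [oU h]; split=> // u Uu.
have [V [q [Vu VU pq e]]] := h u Uu.
exists V, (fun x => (q x)^-1); split=> //; first exact: (@invg_smooth R G n V q pq).
by move=> x Vx /=; rewrite (e _ Vx); exact: qinvE.
Qed.

HB.instance Definition _ := isDiffeologicalGroup.Build R quotient_group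
  qmul_smooth qinv_smooth.

End Quotient.

Section Lie.
Context {R : realType}.
Implicit Types G : diffeologicalGroupType R.

Lemma lmul_smooth G (g : G) : smooth (fun x : G => (g * x)%g).
Proof.
move=> n U p hp; apply: (@mulg_smooth R G n U (fun x => (g, p x))).
by split=> //=; apply: plot_cst; exact: plot_open hp.
Qed.
Definition lmul G (g : G) : smoothMap G G := SmoothMap (lmul_smooth g).

Definition left_invariant G (v : vectorField G) : Prop :=
  forall g h, v (g * h)%g = kan_map (lmul g) (v h).

Definition tangent_space (X : diffeologicalType R) (x : X) :
    diffeologicalType R :=
  set_type ([set z | tpi X z = x] : set (Tan X)).

(* The operations of a Lie algebra over R.  An isomorphism of Lie algebras is a
   bijection that preserves them. *)
Record lieData := LieData {
  lie_sort :> Type;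
  lie_add : lie_sort -> lie_sort -> lie_sort;
  lie_scale : R -> lie_sort -> lie_sort;
  lie_bracket : lie_sort -> lie_sort -> lie_sort }.
Arguments lie_add {_} x y.
Arguments lie_scale {_} t x.
Arguments lie_bracket {_} x y.

Definition lie_isomorphic (L M : lieData) : Prop :=
  exists f : L -> M, [/\ bijective f,
    {morph f : x y / lie_add x y},
    forall t, {morph f : x / lie_scale t x} &
    {morph f : x y / lie_bracket x y}].

Section LieOf.
Variables (G : diffeologicalGroupType R) (EG : elastic G).
Let g := tangent_space (1%g : G).

Definition lie_mk (z : Tan G) (hz : tpi G z = 1%g) : g := exist _ z (mem_set hz).
Lemma lie_tpi (a : g) : tpi G (val a) = 1%g.
Proof. exact: (set_mem (valP a)). Qed.

(* The left-invariant vector field with value x at the unit. *)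
Definition left_field (x : g) : vectorField G :=
  xget (vf_zero G : {classic vectorField G})
    [set v : {classic vectorField G} |
      left_invariant v /\ (v : vectorField G) 1%g = val x].

Definition lieAlgebra : lieData := @LieData g
  (fun x y => lie_mk (etrans (tpi_tadd EG (val x) (val y)) (lie_tpi x)))
  (fun t x => lie_mk (etrans (tpi_tscale t (val x)) (lie_tpi x)))
  (fun x y => lie_mk
     (vf_section (vf_bracket EG (left_field x) (left_field y)) 1%g)).
End LieOf.
End Lie.

Definition diffeologically_discrete (R : realType) (X : diffeologicalType R) :
    Prop :=
  forall n (U : set 'rV[R]_n) (p : 'rV[R]_n -> X), plot U p ->
  forall u, U u -> \forall x \near u, p x = p u.

(* Main.v *)
Require Import Defs.
From HB Require Import structures.
From mathcomp Require Import all_boot all_order all_algebra.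
From Stdlib Require Import Relation_Operators.
From mathcomp Require Import all_classical all_reals all_analysis.
Set Implicit Arguments. Unset Strict Implicit. Unset Printing Implicit Defensive.
Import Order.TTheory GRing.Theory Num.Theory numFieldNormedType.Exports.
Local Open Scope classical_set_scope.
Local Open Scope ring_scope.

(* Since H is discrete, the quotient map G -> G/H is a covering: plots lift
   locally through any prescribed point, and the germ of the lift is unique.
   For a covering f : X -> Y one has TX = X x_Y TY, and Tf and T_k f are again
   coverings.  As every point of T^2 X lies in the image of theta^2, the axioms
   (E1)-(E4) descend from X to Y, and so they do for all tangent powers; for a
   discrete space they hold because its tangent powers are discrete too.
   T_e f is then a linear bijection.  It preserves the bracket because the
   vector fields solving the equation of the bracket on X and on Y correspond
   to each other under f, and a solution is unique as + can be cancelled and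
   lambda is injective. *)

(** Equality in TX is generated by zigzags of plots, so it cannot be read off from representatives.
    The remedy is to carry base points: a class of TY has exactly one lift once a point of X over
    its base point is fixed, and an identity to be proved on Y is moved to classes of X over a
    common base point. Smoothness of a map out of Y or of one of its tangent powers is tested after
    composition with the covering. Two features of the definitions shape the rest. The map [theta2]
    is only known to be surjective, so the flip on Y must be shown to be well defined on its fibres.
    Brackets and left-invariant fields are picked by [xget], so brackets must also be compared when
    the defining equation has no solution on either side. *)

(** * Smooth and linear maps between Euclidean spaces *)

Section Calculus.
Context {R : realType}.

Lemma smooth_on_id (V : normedModType R) (U : set V) : smooth_on U (id : V -> V).
Proof. exact: (@smooth_on_lin R _ _ U idfun (fun x => cvg_id)). Qed.

Lemma smooth_on_differentiable (V W : normedModType R) (U : set V) (f : V -> W) x :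
  smooth_on U f -> U x -> differentiable f x.
Proof. by move=> sf; exact: (sf [::]). Qed.

Lemma smooth_on_upto k (V W : normedModType R) (U : set V) (f : V -> W) :
  smooth_on U f -> smooth_upto k U f.
Proof. by move=> sf s x _; exact: sf. Qed.

Lemma smooth_on_derive (V W : normedModType R) (U : set V) (f : V -> W) v :
  smooth_on U f -> smooth_on U ('D_v f).
Proof. by move=> sf s x Ux; rewrite -iterD_rcons; exact: sf. Qed.

Lemma smooth_onM (V : normedModType R) (U : set V) (f g : V -> R) :
  open U -> smooth_on U f -> smooth_on U g -> smooth_on U (f * g).
Proof.
move=> oU /smooth_upto_smooth sf /smooth_upto_smooth sg.
by apply/smooth_upto_smooth => k; exact: smooth_uptoM.
Qed.

Lemma smooth_on_sum (V W : normedModType R) (U : set V) n (f : 'I_n -> V -> W) :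
  open U -> (forall i, smooth_on U (f i)) ->
  smooth_on U (fun x => \sum_i f i x).
Proof.
move=> oU sf; apply/smooth_upto_smooth => k; apply: smooth_upto_sum => // i.
exact/smooth_on_upto/sf.
Qed.

(** Expansion in the standard basis makes [f] a sum of coordinates times fixed vectors. Continuity
    is then a consequence, whereas [smooth_on_lin] assumes it. *)
Lemma smooth_on_linear m n (U : set 'rV[R]_m) (f : 'rV[R]_m -> 'rV[R]_n) :
  open U -> linear f -> smooth_on U f.
Proof.
move=> oU lf; pose mf := GRing.isLinear.Build _ _ _ _ _ lf.
pose f' : {linear 'rV[R]_m -> 'rV[R]_n} := HB.pack f mf.
have H : smooth_on U (fun x : 'rV[R]_m => \sum_i x 0 i *: f (delta_mx 0 i)).
  apply: smooth_on_sum => // i; apply/smooth_upto_smooth => k.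
  apply: smooth_upto_scl => //.
  exact/smooth_on_upto/((smooth_on_coordP _ oU).1 (@smooth_on_id _ U)).
apply: (smooth_on_eq oU _ H) => x _.
rewrite [in RHS](row_sum x) -[f]/(f' : _ -> _) linear_sum.
by apply: eq_bigr => i _; rewrite linearZ.
Qed.

Lemma continuous_linear m n (f : 'rV[R]_m -> 'rV[R]_n) : linear f -> continuous f.
Proof.
move=> /(smooth_on_linear openT) sf x.
exact: differentiable_continuous (smooth_on_differentiable sf I).
Qed.

Lemma diff_linear m n (f : 'rV[R]_m -> 'rV[R]_n) x : linear f -> 'd f x = f :> (_ -> _).
Proof.
move=> lf; pose mf := GRing.isLinear.Build _ _ _ _ _ lf.
pose f' : {linear 'rV[R]_m -> 'rV[R]_n} := HB.pack f mf.
by rewrite -[f]/(f' : _ -> _) diff_lin//; exact: continuous_linear.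
Qed.

Lemma differentiable_linear m n (f : 'rV[R]_m -> 'rV[R]_n) x :
  linear f -> differentiable f x.
Proof. by move=> lf; exact: (smooth_on_differentiable (smooth_on_linear openT lf)). Qed.

Lemma diff_cstD (V W : normedModType R) (f : V -> W) a x :
  differentiable f x -> 'd (cst a + f) x = 'd f x :> (_ -> _).
Proof.
move=> df; have da : differentiable (cst a : V -> W) x by exact: differentiable_cst.
have dD := diffD da df.
apply/funext => v.
have /(congr1 (@^~ v)) d0 := diff_cst a x.
have -> : 'd (cst a + f) x v = 'd (cst a) x v + 'd f x v.
  exact: (congr1 (@^~ v) dD).
rewrite d0.
exact: add0r.
Qed.

Lemma smooth_on_row_mx (V : normedModType R) m n (U : set V)
    (f : V -> 'rV[R]_m) (g : V -> 'rV[R]_n) :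
  open U -> smooth_on U f -> smooth_on U g ->
  smooth_on U (fun x => row_mx (f x) (g x)).
Proof.
move=> oU sf sg; apply/smooth_on_coordP => // j; case: (split_ordP j) => i ->.
  apply: smooth_on_eq (((smooth_on_coordP _ oU).1 sf) i) => // x _.
  by rewrite row_mxEl.
apply: smooth_on_eq (((smooth_on_coordP _ oU).1 sg) i) => // x _.
by rewrite row_mxEr.
Qed.

Lemma open_T_obj n (U : set 'rV[R]_n) : open U -> open (T_obj U).
Proof.
by move=> oU; have /continuousP := @continuous_lsubmx R 1 n n; exact.
Qed.

Lemma smooth_on_T_mor m n (U : set 'rV[R]_m) (f : 'rV[R]_m -> 'rV[R]_n) :
  open U -> smooth_on U f -> smooth_on (T_obj U) (T_mor f).
Proof.
move=> oU sf; have oT := open_T_obj oU.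
apply: smooth_on_row_mx => //.
  exact: (smooth_on_comp oT oU _ (@smooth_on_lsubmx _ _ _ _) sf).
(* The vector part is linear in v, hence the sum of the v_i times the partial derivatives of [f],
   which are again smooth. *)
have H : smooth_on (T_obj U) (fun w : 'rV[R]_(m + m) =>
    \sum_i (rsubmx w) 0 i *: 'D_(delta_mx 0 i) f (lsubmx w)).
  apply: smooth_on_sum => // i; apply/smooth_on_coordP => // j.
  have s1 : smooth_on (T_obj U) (fun w : 'rV[R]_(m + m) => (rsubmx w) 0 i : R).
    apply: ((smooth_on_coordP _ oT).1 _ i); apply: smooth_on_linear => //.
    by move=> a x y; rewrite linearP.
  have s2 : smooth_on (T_obj U)
      (fun w : 'rV[R]_(m + m) => ('D_(delta_mx 0 i) f (lsubmx w)) 0 j : R).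
    apply: ((smooth_on_coordP _ oT).1 _ j).
    exact: (smooth_on_comp oT oU _ (@smooth_on_lsubmx _ _ _ _) (smooth_on_derive _ sf)).
  apply: (smooth_on_eq oT _ (smooth_onM oT s1 s2)) => w _.
  by rewrite [RHS]mxE.
apply: (smooth_on_eq oT _ H) => w Uw.
have df := smooth_on_differentiable sf Uw.
rewrite [in RHS](row_sum (rsubmx w)) linear_sum.
by apply: eq_bigr => i _; rewrite linearZ/= -deriveE.
Qed.

End Calculus.

(** * Classes of vectors along plots, and naturality of the structure maps *)

Section KanClasses.
Context {R : realType}.
Implicit Types (X Y Z : diffeologicalType R) (F : @efunctor R).

Lemma kan_mk_push F X (p p' : parametrization X) w w'
    (hw : fobj F (pdom p) w) (hw' : fobj F (pdom p') w')
    (f : 'rV[R]_(pdim p) -> 'rV[R]_(pdim p')) :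
  smooth_on (pdom p) f -> (forall x, pdom p x -> pdom p' (f x)) ->
  (forall x, pdom p x -> p x = p' (f x)) -> w' = fmor F f w ->
  kan_mk hw = kan_mk hw'.
Proof. by move=> sf fU pf E; apply/dpi_eq/rst_step; exists f; split. Qed.

Lemma kan_ind F X (P : kan F X -> Prop) :
  (forall p w (hw : fobj F (pdom p) w), P (kan_mk hw)) -> forall z, P z.
Proof.
move=> h z; rewrite -(dreprK z); case: (drepr z) => p a.
have -> : existT (kan_fiber F (X := X)) p a =
    existT _ p (exist _ (val a) (mem_set (kan_sumP (existT _ p a)))).
  by congr existT; exact: val_inj.
exact: h.
Qed.

(** The inclusion of V in U, represented by [id], is a morphism of plots. This serves both to shrink
    a domain and to change a plot outside its domain. *)
Lemma kan_mk_dom F X n (U V : set 'rV[R]_n) (p q : 'rV[R]_n -> X)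
    (hp : plot U p) (hq : plot V q) w (hw : fobj F (pdom (Plot hp)) w)
    (hw' : fobj F (pdom (Plot hq)) w) :
  fmor F id w = w -> V `<=` U -> (forall x, V x -> q x = p x) ->
  kan_mk hw = kan_mk hw'.
Proof.
move=> idF VU pq; apply/esym; apply: (@kan_mk_push _ _ (Plot hq) (Plot hp) w w hw' hw id) => //=.
exact: smooth_on_id.
Qed.

(** A plot of the quotient lifts locally to the coproduct and there stays locally in one summand. So
    near u a single plot [p] of X suffices and only the vector [g s] moves. *)
Lemma kan_plotP F X n (U : set 'rV[R]_n) (Z : 'rV[R]_n -> kan F X) u :
  plot U Z -> U u ->
  exists (V : set 'rV[R]_n) (p : parametrization X)
    (g : 'rV[R]_n -> 'rV[R]_(fdim F (pdim p)))
    (hg : forall s, V s -> fobj F (pdom p) (g s)),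
  [/\ V u, V `<=` U, open V, smooth_on V g & forall s (Vs : V s), Z s = kan_mk (hg s Vs)].
Proof.
move=> hZ Uu; have [_ /(_ u Uu)[V [r [Vu VU [_ hr] qr]]]] := hZ.
have [W [p [g [Wu WV [oW sg] rg]]]] := hr u Vu.
exists W, p, (fun s => val (g s)), (fun s _ => set_mem (valP (g s))); split=> //.
  exact: subset_trans VU.
move=> s Ws; rewrite qr ?rg//; last exact: WV.
by congr (dpi _ (existT _ _ _)); exact: val_inj.
Qed.

Lemma smooth_fibprod k X Y Z (f : X -> Y) (phi : Z -> fibprod k f) :
  (forall i, smooth (fun z => val (phi z) i : X)) -> smooth phi.
Proof.
move=> sphi n U p hp; split; first exact: plot_open hp.
by move=> i; exact: sphi.
Qed.

Lemma smooth_comp X Y Z (f : X -> Y) (g : Y -> Z) :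
  smooth f -> smooth g -> smooth (g \o f).
Proof. by move=> sf sg n U p /sf/sg. Qed.

(* The base point map of an endofunctor F over the identity, as it occurs for
   T, T_k and T^2: F U is the preimage of U under a linear map b. *)
Record based F (b : forall n, 'rV[R]_(fdim F n) -> 'rV[R]_n) : Prop := Based {
  based_linear : forall n, linear (@b n);
  based_obj : forall n (U : set 'rV[R]_n) w, fobj F U w <-> U (b n w);
  based_id : forall n w, fmor F (id : 'rV[R]_n -> _) w = w }.

Lemma open_fobj F b : @based F b -> forall n (U : set 'rV[R]_n),
  open U -> open (fobj F U).
Proof.
move=> bF n U oU; have -> : fobj F U = @b n @^-1` U.
  by apply/seteqP; split=> w; case: (based_obj bF U w).
by have /continuousP := continuous_linear (@based_linear _ _ bF n); exact.
Qed.

(** By the local form of plots, a map of Kan extensions is smooth as soon as it is given by a smooth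
    formula [g] on each summand. *)
Lemma kan_smooth F F' X Y b (bF : @based F b) (phi : kan F X -> kan F' Y) :
  (forall p, exists (p' : parametrization Y)
      (g : 'rV[R]_(fdim F (pdim p)) -> 'rV[R]_(fdim F' (pdim p'))),
    smooth_on (fobj F (pdom p)) g /\
    forall w (hw : fobj F (pdom p) w),
      exists hw' : fobj F' (pdom p') (g w), phi (kan_mk hw) = kan_mk hw') ->
  smooth phi.
Proof.
move=> h n U Z hZ; apply: plot_local (plot_open hZ) _ => u Uu.
have [V [p [g [hg [Vu VU oV sg Zg]]]]] := kan_plotP hZ Uu.
have [p' [g' [sg' E]]] := h p.
exists V, (phi \o Z); split=> //.
have hg' s : V s -> fobj F' (pdom p') ((g' \o g) s).
  by move=> Vs; have [] := E _ (hg s Vs).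
apply: (kan_plot (hg := hg')) => //.
  exact: (smooth_on_comp oV (open_fobj bF (plot_open (pplot p))) hg sg sg').
move=> s Vs /=; rewrite (Zg s Vs); have [hw' ->] := E _ (hg s Vs).
by rewrite (Prop_irrelevance hw' (hg' s Vs)).
Qed.

Lemma kan_map_smooth F b X Y (f : smoothMap X Y) :
  @based F b -> smooth (kan_map f : kan F X -> kan F Y).
Proof.
move=> bF; apply: (kan_smooth bF) => p.
exists (Plot (kan_push_plot f p)), id; split; first exact: smooth_on_id.
by move=> w hw; exists hw; exact: kan_mapE.
Qed.

Lemma kan_nat_smooth F F' b (alpha : enat F F') X :
  @based F b -> natural alpha -> (forall n, linear (@ecomp _ _ _ alpha n)) ->
  smooth (kan_nat alpha (X := X) : kan F X -> kan F' X).
Proof.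
move=> bF nat la; apply: (kan_smooth bF) => p.
exists p, (@ecomp _ _ _ alpha _); split.
  exact: smooth_on_linear (open_fobj bF (plot_open (pplot p))) (la _).
by move=> w hw; exists (ecompP alpha hw); exact: kan_natE.
Qed.

Lemma kan_map_nat F F' (alpha : enat F F') X Y (f : smoothMap X Y) z :
  natural alpha -> kan_map f (kan_nat alpha z) = kan_nat alpha (kan_map f z).
Proof.
by move=> nat; elim/kan_ind: z => p w hw; rewrite kan_natE// !kan_mapE kan_natE.
Qed.

Lemma kan_map_comp F b X Y Z (f : smoothMap X Y) (g : smoothMap Y Z)
    (h : smoothMap X Z) (z : kan F X) :
  @based F b -> h =1 g \o f -> kan_map g (kan_map f z) = kan_map h z.
Proof.
move=> bF hE; elim/kan_ind: z => p w hw; rewrite !kan_mapE.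
apply: kan_mk_dom => //; first exact: (based_id bF).
by move=> x _ /=; rewrite hE.
Qed.

Lemma based_T : @based T_hat (fun n => lsubmx).
Proof.
split=> [n a x y|//|n w]; first by rewrite linearP.
exact: T_mor_id.
Qed.

Lemma based_T2 : @based T2_hat (fun n w => lsubmx (lsubmx w)).
Proof.
split=> [n a x y|//|n w]; first by rewrite !linearP.
rewrite /= -[RHS]T_mor_id; congr (T_mor _ w).
by apply/funext => v; exact: T_mor_id.
Qed.

Lemma based_Tk k : @based (Tk_hat k) (fun n => lsubmx).
Proof.
split=> [n a x y|//|n w]; first by rewrite linearP.
rewrite /= -[RHS]hsubmxK; congr row_mx.
rewrite -[RHS]vec_mxK; congr mxvec; apply/row_matrixP => i.
by rewrite rowK (diff_lin (f := idfun)) // => x; exact: cvg_id.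
Qed.

Lemma kan_map_smoothT X Y (f : smoothMap X Y) :
  smooth (kan_map f : Tan X -> Tan Y).
Proof. exact: kan_map_smooth based_T. Qed.

Definition Tmap X Y (f : smoothMap X Y) : smoothMap (Tan X) (Tan Y) :=
  SmoothMap (kan_map_smoothT f).

Lemma tpi_kan_map X Y (f : smoothMap X Y) z : tpi Y (kan_map f z) = f (tpi X z).
Proof.
elim/kan_ind: z => p w hw.
by rewrite kan_mapE /tpi /= !tpi_mk.
Qed.

Lemma natural_proj k (i : 'I_k) : natural (@proj_hat R k i).
Proof.
move=> m n U V f w oU oV sf fV Uw /=.
by rewrite /T_mor /vec_i !row_mxKl !row_mxKr mxvecK rowK.
Qed.

Lemma linear_vec_i k (i : 'I_k) n : linear (@vec_i R k n i).
Proof. by move=> a x y; rewrite /vec_i !linearP. Qed.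

Lemma linear_row_mx m n p (f : 'rV[R]_m -> 'rV[R]_n) (g : 'rV[R]_m -> 'rV[R]_p) :
  linear f -> linear g -> linear (fun x => row_mx (f x) (g x)).
Proof. by move=> lf lg a x y; rewrite lf lg scale_row_mx add_row_mx. Qed.

Lemma linear_lsubmx m n : linear (lsubmx : 'rV[R]_(m + n) -> 'rV[R]_m).
Proof. by move=> a x y; rewrite linearP. Qed.
Lemma linear_rsubmx m n : linear (rsubmx : 'rV[R]_(m + n) -> 'rV[R]_n).
Proof. by move=> a x y; rewrite linearP. Qed.

Lemma smooth_kan_proj k (i : 'I_k) X :
  smooth (kan_nat (proj_hat i) (X := X) : kan (Tk_hat k) X -> Tan X).
Proof.
apply: kan_nat_smooth (based_Tk k) (natural_proj i) _ => n.
exact: linear_row_mx (@linear_lsubmx _ _) (@linear_vec_i _ _ _).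
Qed.

Lemma theta_smooth k X : smooth (@theta R k X).
Proof. by apply: smooth_fibprod => i; exact: smooth_kan_proj. Qed.

Lemma natural_plus : natural (@plus_hat R).
Proof.
move=> m n U V f w oU oV sf fV Uw /=.
by rewrite /T_mor /vec_i !row_mxKl !row_mxKr mxvecK !rowK linearD.
Qed.

Lemma natural_scale t : natural (@scale_hat R t).
Proof.
move=> m n U V f w oU oV sf fV Uw /=.
by rewrite /T_mor !row_mxKl !row_mxKr linearZ.
Qed.

Lemma T_mor_row m n (f : 'rV[R]_m -> 'rV[R]_n) u v :
  T_mor f (row_mx u v) = row_mx (f u) ('d f u v).
Proof. by rewrite /T_mor row_mxKl row_mxKr. Qed.

(** The point is the derivative of Tf at (u,0) in the direction (0,v). Along the fibre inclusion
    [c], v |-> (u,v), the map Tf is a constant plus the linear map [l], so the chain rule gives (0,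
    df v) and no second derivative of [f] enters. *)
Lemma natural_lambda : natural (@lambda_hat R).
Proof.
move=> m n U V f w oU oV sf fV Uw /=.
rewrite {1}/lambda_comp T_mor_row T_mor_row linear0.
rewrite /lambda_comp [lsubmx (T_mor f w)]row_mxKl [rsubmx (T_mor f w)]row_mxKr.
congr row_mx.
pose j (v : 'rV[R]_m) : 'rV[R]_(m + m) := row_mx 0 v.
have lj : linear j.
  by apply: linear_row_mx => // a x y; rewrite scaler0 addr0.
pose c : 'rV[R]_m -> 'rV[R]_(m + m) := cst (row_mx (lsubmx w) 0) + j.
have dj v : differentiable j v by exact: differentiable_linear.
have dc v : differentiable c v.
  by apply: differentiableD => //; exact: differentiable_cst.
have cE v : c v = row_mx (lsubmx w) v by rewrite /c !fctE /j add_row_mx addr0 add0r.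
pose l (v : 'rV[R]_m) : 'rV[R]_(n + n) := row_mx 0 ('d f (lsubmx w) v).
have ll : linear l.
  apply: linear_row_mx => a x y; first by rewrite scaler0 addr0.
  by rewrite linearP.
have Tc : T_mor f \o c = cst (row_mx (f (lsubmx w)) 0) + l.
  apply/funext => v; rewrite !fctE /= cE /T_mor row_mxKl row_mxKr.
  by rewrite /l add_row_mx addr0 add0r.
have dT : differentiable (T_mor f) (c 0).
  apply: (smooth_on_differentiable (smooth_on_T_mor oU sf)).
  by rewrite /T_obj /= cE row_mxKl.
have dcE : 'd c 0 = j :> (_ -> _).
  by rewrite /c diff_cstD//; exact: diff_linear.
have dTc : 'd (T_mor f \o c) 0 = l :> (_ -> _).
  by rewrite Tc diff_cstD; [exact: diff_linear|exact: differentiable_linear].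
have /(congr1 (@^~ (rsubmx w))) := diff_comp (dc 0) dT.
by rewrite dTc dcE cE /= => <-.
Qed.

Lemma T_plotE X (p : parametrization X) w (hw : fobj T_hat (pdom p) w) :
  T_plot p w = kan_mk hw.
Proof.
rewrite /= /T_plot_fun; case: pselect => // h.
by rewrite (Prop_irrelevance h hw).
Qed.

(** Independence of the representative: a morphism [g] from the plot p to the plot p' induces the
    morphism Tg from Tp to Tp'. *)
Lemma theta2_mk X (p : parametrization X) w (hw : fobj T2_hat (pdom p) w) :
  theta2 (kan_mk hw) = @kan_mk _ T_hat (Tan X) (T_plot p) w hw.
Proof.
pose h (a : kan_sum T2_hat X) :=
  @kan_mk _ T_hat (Tan X) (T_plot (projT1 a)) _ (kan_sumP a).
rewrite [LHS](@dlift_repr _ _ _ _ h) => [|a b [g [sg gU pg E]]].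
  by rewrite /h /kan_mk; congr (dpi _ (existT _ _ _)); exact: val_inj.
apply: (@kan_mk_push _ _ (T_plot _) (T_plot _) _ _ _ _ (T_mor g)) => //.
- exact: smooth_on_T_mor (plot_open (pplot (projT1 a))) sg.
- by move=> x Ux; rewrite /= /T_obj /= row_mxKl; exact: gU.
move=> x Ux; rewrite (T_plotE Ux).
have h' : fobj T_hat (pdom (projT1 b)) (T_mor g x).
  by rewrite /= /T_obj /= row_mxKl; exact: gU.
by rewrite (T_plotE h'); exact: (@kan_mk_push T_hat X _ _ x _ Ux h' g).
Qed.

Lemma theta2_smooth X : smooth (@theta2 R X).
Proof.
apply: (kan_smooth based_T2) => p; exists (T_plot p), id.
by split=> [|w hw]; [exact: smooth_on_id|exists hw; exact: theta2_mk].
Qed.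

(* A plot P of TX is locally of the form s |-> p_* (g s) = T p (g s), so that
   P_* w = (T p)_* (T g w). *)
Lemma theta2_surj X (z : Tan (Tan X)) : exists c, theta2 c = z.
Proof.
elim/kan_ind: z => P w hw.
have [V [p [g [hg [Vu VU oV sg Pg]]]]] := kan_plotP (pplot P) hw.
have hw' : fobj T2_hat (pdom p) (T_mor g w).
  by rewrite /= /T_obj /= row_mxKl; exact: (hg _ Vu).
exists (kan_mk hw'); rewrite theta2_mk.
have hV : plot V P by exact: plot_sub oV VU (pplot P).
have hwV : fobj T_hat (pdom (Plot hV)) w by [].
transitivity (kan_mk hwV).
  apply/esym; apply: (@kan_mk_push _ _ (Plot hV) (T_plot p) _ _ _ _ g) => //.
  by move=> x Vx; rewrite (T_plotE (hg x Vx)); exact: Pg.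
apply: (@kan_mk_push _ _ (Plot hV) P _ _ _ _ id) => //.
- exact: smooth_on_id.
- by rewrite /= T_mor_id.
Qed.

Lemma theta2_kan_map X Y (f : smoothMap X Y) c :
  kan_map (Tmap f) (theta2 c) = theta2 (kan_map f c).
Proof.
elim/kan_ind: c => p w hw; rewrite theta2_mk !kan_mapE theta2_mk.
apply: (@kan_mk_push T_hat (Tan Y) (Plot (kan_push_plot (Tmap f) (T_plot p)))
  (T_plot (Plot (kan_push_plot f p))) w w hw hw id) => //.
- exact: smooth_on_id.
- move=> x Ux; transitivity (kan_map f (T_plot p x)) => //.
  by rewrite (T_plotE Ux) kan_mapE (@T_plotE Y (Plot (kan_push_plot f p)) _ Ux).
- by rewrite /= T_mor_id.
Qed.

Lemma lambda_smooth X : smooth (@lambda R X).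
Proof.
apply: smooth_comp (@theta2_smooth X).
apply: kan_nat_smooth based_T natural_lambda _ => n.
have l0 p q : linear (fun _ : 'rV[R]_p => 0 : 'rV[R]_q).
  by move=> a x y; rewrite scaler0 addr0.
by do !apply: linear_row_mx; do ?exact: l0;
  [exact: linear_lsubmx|exact: linear_rsubmx].
Qed.

Lemma lambda_kan_map X Y (f : smoothMap X Y) z :
  kan_map (Tmap f) (lambda z) = lambda (kan_map f z).
Proof. by rewrite /lambda theta2_kan_map kan_map_nat//; exact: natural_lambda. Qed.

Lemma theta_kan_map k X Y (f : smoothMap X Y) z i :
  val (theta (kan_map f z)) i = kan_map f (val (@theta R k X z) i).
Proof. by rewrite /= kan_map_nat//; exact: natural_proj. Qed.

End KanClasses.

(** * Etale maps and coverings, and their lifts to T and T_k *)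

Section Etale.
Context {R : realType}.
Implicit Types X Y Z : diffeologicalType R.

(** Phrased by local lifts of plots through a prescribed point and by uniqueness of their germs,
    because it is this form that passes to T and T_k. *)
Definition etale X Y (f : smoothMap X Y) : Prop :=
  (forall n (U : set 'rV[R]_n) (p : 'rV[R]_n -> Y) u x,
    plot U p -> U u -> f x = p u ->
    exists V (q : 'rV[R]_n -> X), [/\ V u, V `<=` U, plot V q, q u = x &
      forall s, V s -> f (q s) = p s]) /\
  (forall n (U : set 'rV[R]_n) (p q : 'rV[R]_n -> X) u,
    plot U p -> plot U q -> U u -> (forall s, U s -> f (p s) = f (q s)) ->
    p u = q u -> \forall s \near u, p s = q s).

Definition covering X Y (f : smoothMap X Y) : Prop :=
  etale f /\ forall y, exists x, f x = y.

Lemma near_open (T : topologicalType) (u : T) (P : T -> Prop) :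
  (\forall s \near u, P s) -> exists W, [/\ open W, W u & forall s, W s -> P s].
Proof.
move=> h; have : nbhs u P by [].
by rewrite nbhsE => -[W [oW Wu] WP]; exists W.
Qed.

(** A covering is a subduction: every plot of Y lifts locally to X. *)
Lemma covering_smooth X Y Z (f : smoothMap X Y) (g : Y -> Z) :
  covering f -> smooth (g \o f) -> smooth g.
Proof.
move=> [[lift _] surj] sgf n U p hp; apply: (plot_local (plot_open hp)) => u Uu.
have [x fx] := surj (p u); have [V [q [Vu VU hq _ fq]]] := lift _ _ _ _ _ hp Uu fx.
by exists V, (g \o f \o q); split=> //; [exact: sgf|move=> s Vs /=; rewrite fq].
Qed.

Lemma kan_map_lift F b X Y (f : smoothMap X Y) (p : parametrization Y)
    (V : set 'rV[R]_(pdim p)) (q : 'rV[R]_(pdim p) -> X) (hq : plot V q) w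
    (hw : fobj F (pdom p) w) (hw' : fobj F (pdom (Plot hq)) w) :
  @based _ F b -> V `<=` pdom p -> (forall s, V s -> f (q s) = p s) ->
  kan_map f (kan_mk hw') = kan_mk hw.
Proof.
case: p V q hq w hw hw' => n U p hp V q hq w hw hw' bF /= VU fq.
rewrite kan_mapE; apply/esym; apply: (@kan_mk_dom _ F Y n U V p _ hp _ w hw hw') => //.
exact: (based_id bF).
Qed.

(* Lifting plots through x is compatible with kan_rel; thus a zigzag of pairs
   in the coproduct of Y lifts to an equality in TX. *)
Definition lift_class X Y (f : smoothMap X Y) (a : kan_sum T_hat Y) (x : X)
    (z : Tan X) : Prop :=
  exists V (q : 'rV[R]_(pdim (projT1 a)) -> X) (hq : plot V q)
    (hw : fobj T_hat (pdom (Plot hq)) (val (projT2 a))),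
    [/\ V `<=` pdom (projT1 a), forall s, V s -> f (q s) = projT1 a s,
        q (lsubmx (val (projT2 a))) = x & z = kan_mk hw].

(** Two lifts with the same value at the base point agree near it, and restriction to that
    neighbourhood does not change the class. *)
Lemma lift_class_fun X Y (f : smoothMap X Y) a x z z' : etale f ->
  lift_class f a x z -> lift_class f a x z' -> z = z'.
Proof.
move=> [_ uniq] [V [q [hq [hw [VU fq qx ->]]]]] [V' [q' [hq' [hw' [VU' fq' qx' ->]]]]].
set u := lsubmx (val (projT2 a)) in qx qx'.
have oV := plot_open hq; have oV' := plot_open hq'.
have oI : open (V `&` V') by exact: openI.
have [W [oW Wu Wq]] : exists W, [/\ open W, W u & forall s, W s -> q s = q' s].
  apply: near_open; apply: (uniq _ (V `&` V')) => //.
  - by apply: (plot_sub _ _ hq) => // s [].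
  - by apply: (plot_sub _ _ hq') => // s [].
  - by move=> s [Vs V's]; rewrite fq ?fq'.
  - by rewrite qx qx'.
have hr : plot (W `&` (V `&` V')) q.
  by apply: (plot_sub _ _ hq); [exact: openI|move=> s [_ []]].
have hwr : fobj T_hat (pdom (Plot hr)) (val (projT2 a)) by [].
transitivity (kan_mk hwr).
  by apply: kan_mk_dom => //; [exact: T_mor_id|move=> s [_ []]].
apply/esym; apply: kan_mk_dom => //; [exact: T_mor_id|by move=> s [_ []]|].
by move=> s [/Wq].
Qed.

Definition sum_base Y (a : kan_sum T_hat Y) : Y :=
  projT1 a (lsubmx (val (projT2 a))).

(** If [g] is the morphism from a to b and q lifts the plot of b, then q o g lifts the plot of a,
    and [g] itself identifies the two lifted classes. *)
Lemma lift_class_rel X Y (f : smoothMap X Y) a b x : etale f -> kan_rel a b ->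
  f x = sum_base a -> exists z, lift_class f a x z /\ lift_class f b x z.
Proof.
move=> ef [g [sg gU pg E]] fx.
have Ua := kan_sumP a; have Ub := kan_sumP b.
have bE : lsubmx (val (projT2 b)) = g (lsubmx (val (projT2 a))).
  by rewrite E /= /T_mor row_mxKl.
have fx' : f x = projT1 b (lsubmx (val (projT2 b))).
  by rewrite fx /sum_base pg// bE.
have [V [q [Vu VU hq qx fq]]] := ef.1 _ _ _ _ _ (pplot (projT1 b)) Ub fx'.
have hw : fobj T_hat (pdom (Plot hq)) (val (projT2 b)) by [].
exists (kan_mk hw); split; last by exists V, q, hq, hw.
have oa := plot_open (pplot (projT1 a)).
have oI := open_smooth_preimage oa sg (plot_open hq).
have hq' : plot (pdom (projT1 a) `&` g @^-1` V) (q \o g).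
  by apply: (plot_comp hq oI) => [s y [Uy _]|y []//]; exact: sg.
have hw' : fobj T_hat (pdom (Plot hq')) (val (projT2 a)).
  by split; [exact: Ua|rewrite /preimage /= -bE; exact: Vu].
exists _, _, hq', hw'; split.
- by move=> s [].
- by move=> s [Us Vs]; rewrite fq ?pg.
- by rewrite /= -bE.
apply/esym; apply: (@kan_mk_push _ T_hat X (Plot hq') (Plot hq) _ _ hw' hw g) => //.
- by move=> s y [Uy _]; exact: sg.
- by move=> s [].
Qed.

(** Equality of base points is carried through the induction so that the same x is available at
    every link of the zigzag. *)
Lemma lift_class_clos X Y (f : smoothMap X Y) a b : etale f ->
  clos_refl_sym_trans _ (@kan_rel _ T_hat Y) a b ->
  sum_base a = sum_base b /\ forall x z, f x = sum_base a ->
    (lift_class f a x z <-> lift_class f b x z).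
Proof.
move=> ef; elim=> {a b} [a b ab|a|a b _ [E h]|a b c _ [E1 h1] _ [E2 h2]].
- have E : sum_base a = sum_base b.
    case: ab => g [sg gU pg E]; rewrite /sum_base E /= /T_mor row_mxKl.
    by apply: pg; exact: (kan_sumP a).
  split=> // x z fx; have [z0 [za zb]] := lift_class_rel ef ab fx.
  split=> [h|h]; first by rewrite (lift_class_fun ef h za).
  by rewrite (lift_class_fun ef h zb).
- by [].
- by split=> // x z fx; rewrite -h// E.
- split=> [|x z fx]; first by rewrite E1.
  by rewrite h1// h2// -E1.
Qed.

Lemma lift_class_push X Y (f : smoothMap X Y) (p : parametrization X) w
    (hw : fobj T_hat (pdom p) w) :
  lift_class f (existT (kan_fiber T_hat (X := Y)) (Plot (kan_push_plot f p))
    (exist _ w (mem_set hw))) (p (lsubmx w)) (kan_mk hw).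
Proof. by case: p w hw => n U p hp w hw; exists U, p, hp, hw; split. Qed.

(* TX is the pullback of TY along an etale map X -> Y. *)
Lemma etale_tan_inj X Y (f : smoothMap X Y) (z z' : Tan X) : etale f ->
  tpi X z = tpi X z' -> kan_map f z = kan_map f z' -> z = z'.
Proof.
move=> ef; elim/(@kan_ind R T_hat): z => p w hw; elim/(@kan_ind R T_hat): z' => p' w' hw'.
rewrite !kan_mapE /tpi /= !tpi_mk => pE /dpi_eq/(lift_class_clos ef)[_ h].
have la := lift_class_push f hw; have lb := lift_class_push f hw'.
rewrite -pE in lb.
exact: lift_class_fun ef ((h _ (kan_mk hw) (erefl _)).1 la) lb.
Qed.

Lemma etale_Tmap X Y (f : smoothMap X Y) : etale f -> etale (Tmap f).
Proof.
move=> ef; split=> [n U P u z hP Uu fz|n U P Q u hP hQ Uu fPQ Pu].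
  (* Locally P is Tp o g. A lift q of p through the base point of z gives the lift Tq o g of P. *)
  have [V [p [g [hg [Vu VU oV sg Pg]]]]] := kan_plotP hP Uu.
  have fx : f (tpi X z) = p (lsubmx (g u)).
    rewrite -tpi_kan_map; move: fz => /= ->.
    by rewrite (Pg u Vu) tpi_mk.
  have [W [q [Wu WU hq qx fq]]] := ef.1 _ _ _ _ _ (pplot p) (hg u Vu) fx.
  have oT := open_T_obj (plot_open hq).
  have oI := open_smooth_preimage oV sg oT.
  have fQ s : V s -> T_obj W (g s) -> kan_map f (T_plot (Plot hq) (g s)) = P s.
    move=> Vs Ws; rewrite (@T_plotE _ _ (Plot hq) _ Ws) (Pg s Vs).
    exact: (kan_map_lift _ _ based_T).
  exists (V `&` g @^-1` T_obj W), (T_plot (Plot hq) \o g); split.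
  - by [].
  - by move=> s [/VU].
  - by apply: (plot_comp (pplot (T_plot (Plot hq))) oI) => [s y [Vy _]|y []//]; exact: sg.
  - apply: (etale_tan_inj ef); last exact: etrans (fQ u Vu Wu) (esym fz).
    have E : (T_plot (Plot hq) \o g) u = kan_mk _ := @T_plotE _ _ (Plot hq) _ Wu.
    by rewrite E /= tpi_mk.
  - by move=> s [Vs Ws]; exact: fQ.
(* The base points of P and Q lift the same plot of Y, so they agree near u; with equal images in TY
   this forces P = Q there. *)
have H : \forall s \near u, (tpi X \o P) s = (tpi X \o Q) s.
  apply: (ef.2 _ U); [exact: smooth_funP|exact: smooth_funP|by []| |].
    by move=> s Us; rewrite /= -!tpi_kan_map; congr (tpi Y _); exact: fPQ.
  by rewrite /= Pu.
have HU : \forall s \near u, U s by apply: open_nbhs_nbhs; split=> //; exact: plot_open hP.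
apply: filterS2 H HU => s E Us.
by apply: (etale_tan_inj ef) => //; exact: fPQ.
Qed.

Lemma etale_tan_lift X Y (f : smoothMap X Y) (y : Tan Y) x : etale f ->
  f x = tpi Y y -> exists2 z, tpi X z = x & kan_map f z = y.
Proof.
move=> ef; elim/(@kan_ind R T_hat): y => p w hw; rewrite /tpi /= tpi_mk => fx.
have [W [q [Wu WU hq qx fq]]] := ef.1 _ _ _ _ _ (pplot p) hw fx.
have hw' : fobj T_hat (pdom (Plot hq)) w by [].
exists (kan_mk hw'); first by rewrite tpi_mk.
exact: (kan_map_lift _ _ based_T).
Qed.

Lemma covering_Tmap X Y (f : smoothMap X Y) : covering f -> covering (Tmap f).
Proof.
move=> [ef surj]; split=> [|y]; first exact: etale_Tmap.
have [x fx] := surj (tpi Y y).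
by have [z _ zy] := etale_tan_lift ef fx; exists z.
Qed.

Lemma Tk_tpi k X (z : Tk k X) i j : tpi X (val z i) = tpi X (val z j).
Proof. exact: (set_mem (valP z)). Qed.

Lemma Tk_map_subproof k X Y (f : smoothMap X Y) (z : Tk k X) i j :
  tpi Y (kan_map f (val z i)) = tpi Y (kan_map f (val z j)).
Proof. by rewrite !tpi_kan_map (Tk_tpi z i j). Qed.

Definition Tk_map_fun k X Y (f : smoothMap X Y) (z : Tk k X) : Tk k Y :=
  fib_mk (x := fun i => kan_map f (val z i)) (Tk_map_subproof f z).

Lemma Tk_map_smooth k X Y (f : smoothMap X Y) : smooth (@Tk_map_fun k X Y f).
Proof.
apply: smooth_fibprod => i; exact: (smooth_comp (@Tk_proj_smooth R k X i) (kan_map_smoothT f)).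
Qed.

Definition Tk_map k X Y (f : smoothMap X Y) : smoothMap (Tk k X) (Tk k Y) :=
  SmoothMap (@Tk_map_smooth k X Y f).

Lemma Tk_eq k X (z z' : Tk k X) : (forall i, val z i = val z' i) -> z = z'.
Proof. by move=> h; apply: val_inj; exact: funext. Qed.

Lemma etale_Tk k X Y (f : smoothMap X Y) : (0 < k)%N -> etale f -> etale (Tk_map k f).
Proof.
move=> k0 ef; have eT := etale_Tmap ef; pose i0 := Ordinal k0.
split=> [n U P u z hP Uu fz|n U P Q u hP hQ Uu fPQ Pu]; last first.
  have H i : \forall s \near u, val (P s) i = val (Q s) i.
    apply: (eT.2 _ U (fun s => val (P s) i) (fun s => val (Q s) i)) => //.
    - exact: hP.2.
    - exact: hQ.2.
    - by move=> s Us; have /(congr1 (fun t => val t i)) := fPQ s Us.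
    - by rewrite Pu.
  apply: filterS (@filter_forall _ _ (fun i s => val (P s) i = val (Q s) i) _ _ H) => s.
  exact: Tk_eq.
have /choice[V /choice[q hq]] : forall i : 'I_k, exists V (q : 'rV[R]_n -> Tan X),
    [/\ V u, V `<=` U, plot V q, q u = val z i &
     forall s, V s -> kan_map f (q s) = val (P s) i].
  move=> i; apply: (eT.1 _ _ (fun s => val (P s) i)) => //; first exact: hP.2.
  exact: (congr1 (fun t => val t i) fz).
have oV i : open (V i) by have [_ _ /plot_open] := hq i.
(* The k components were lifted separately, so their base points must be matched. All are lifts of
   one plot of Y agreeing at u, hence agree near u with those of the reference component [i0]; this
   uses [0 < k]. *)
have H i : \forall s \near u, V i s /\ tpi X (q i s) = tpi X (q i0 s).
  have oI : open (V i `&` V i0) by exact: openI.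
  have [Vu VU pq qu fq] := hq i; have [Vu0 VU0 pq0 qu0 fq0] := hq i0.
  have H1 : \forall s \near u, V i s by apply: open_nbhs_nbhs; split.
  have H2 : \forall s \near u, (tpi X \o q i) s = (tpi X \o q i0) s.
    apply: (ef.2 _ (V i `&` V i0)) => //.
    - by apply: smooth_funP; apply: (plot_sub _ _ pq) => // s [].
    - by apply: smooth_funP; apply: (plot_sub _ _ pq0) => // s [].
    - move=> s [Vs V0s]; rewrite /= -!tpi_kan_map fq ?fq0//; exact: Tk_tpi.
    - by rewrite /= qu qu0; exact: Tk_tpi.
  by apply: filterS2 H1 H2.
have [W [oW Wu hW]] := near_open (@filter_forall _ _
  (fun i s => V i s /\ tpi X (q i s) = tpi X (q i0 s)) _ _ H).
pose Q s : Tk k X := if pselect (forall i j, tpi X (q i s) = tpi X (q j s)) is left h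
  then fib_mk (x := fun i => q i s) h else z.
have QE s i : W s -> val (Q s) i = q i s.
  move=> Ws; rewrite /Q; case: pselect => //= h; exfalso; apply: h => j l.
  exact: etrans (hW s Ws j).2 (esym (hW s Ws l).2).
exists W, Q; split=> //.
- by move=> s Ws; have [_ VU _ _ _] := hq i0; exact/VU/(hW s Ws i0).1.
- split=> // i; have [_ _ pq _ _] := hq i.
  apply: (plot_eq (p := q i)); first by move=> s Ws; rewrite QE.
  by apply: (plot_sub _ _ pq) => // s Ws; exact: (hW s Ws i).1.
- by apply: Tk_eq => i; rewrite QE//; have [] := hq i.
- move=> s Ws; apply: Tk_eq => i /=; rewrite QE//; have [_ _ _ _ fq] := hq i.
  exact/fq/(hW s Ws i).1.
Qed.

Lemma covering_Tk k X Y (f : smoothMap X Y) : (0 < k)%N -> covering f ->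
  covering (Tk_map k f).
Proof.
move=> k0 [ef surj]; split=> [|y]; first exact: etale_Tk.
(* One point x is chosen for all k vectors, so that their lifts lie in one fibre. *)
have [x fx] := surj (tpi Y (val y (Ordinal k0))).
have /choice[z hz] : forall i, exists z, tpi X z = x /\ kan_map f z = val y i.
  move=> i; have [|z] := @etale_tan_lift _ _ f (val y i) x ef; last by exists z.
  by rewrite fx; exact: Tk_tpi.
have h i j : tpi X (z i) = tpi X (z j) by rewrite (hz i).1 (hz j).1.
by exists (fib_mk (x := z) h); apply: Tk_eq => i; exact: (hz i).2.
Qed.

End Etale.

(** * Descent of the elastic axioms along a covering *)

Section Transfer.
Context {R : realType}.
Implicit Types X Y Z : diffeologicalType R.

Lemma tpi_theta k X (p : parametrization X) w (hw : fobj (Tk_hat k) (pdom p) w) i :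
  tpi X (val (theta (kan_mk hw)) i) = p (lsubmx w).
Proof. by rewrite /= (kan_natE _ (natural_proj i)) tpi_mk /= row_mxKl. Qed.

Lemma tpi2_theta2 X (p : parametrization X) w (hw : fobj T2_hat (pdom p) w) :
  tpi X (tpi _ (theta2 (kan_mk hw))) = p (lsubmx (lsubmx w)).
Proof.
rewrite theta2_mk -[tpi _ (kan_mk _)]/(tpi_fun (kan_mk _)) tpi_mk.
by rewrite (@T_plotE _ _ _ _ hw) /= tpi_mk.
Qed.

Lemma tpi2_lambda X (z : Tan X) : tpi X (tpi _ (lambda z)) = tpi X z.
Proof.
elim/(@kan_ind R T_hat): z => p w hw.
rewrite /lambda (kan_natE _ natural_lambda) tpi2_theta2.
by rewrite [RHS]tpi_mk /= !row_mxKl.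
Qed.

Lemma tpi_nu k X (z : Tan (Tk k X)) i :
  tpi _ (val (nu z) i) = val (tpi _ z) i.
Proof. exact: tpi_kan_map. Qed.

Lemma etale_tan2_inj X Y (f : smoothMap X Y) (z z' : Tan (Tan X)) : etale f ->
  tpi X (tpi _ z) = tpi X (tpi _ z') ->
  kan_map (Tmap f) z = kan_map (Tmap f) z' -> z = z'.
Proof.
move=> ef zz' fzz'; apply: (etale_tan_inj (etale_Tmap ef)) => //.
apply: (etale_tan_inj ef) => //.
have := congr1 (tpi _) fzz'; rewrite !tpi_kan_map; exact.
Qed.

Lemma etale_kan_lift F b X Y (f : smoothMap X Y) (p : parametrization Y) w x :
  @based _ F b -> etale f -> fobj F (pdom p) w -> f x = p (b _ w) ->
  exists V (q : 'rV[R]_(pdim p) -> X) (hq : plot V q),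
    [/\ fobj F (pdom (Plot hq)) w, V `<=` pdom p,
        forall s, V s -> f (q s) = p s & q (b _ w) = x].
Proof.
move=> bF ef /(based_obj bF) hw fx.
have [V [q [Vu VU hq qx fq]]] := ef.1 _ _ _ _ _ (pplot p) hw fx.
by exists V, q, hq; split=> //; apply/(based_obj bF).
Qed.

(** An equality on Y can be compared on X only between lifts over the same point; this supplies such
    a pair of lifts. *)
Lemma covering_kan_lift2 F b X Y (f : smoothMap X Y) (p p' : parametrization Y) w w'
    (hw : fobj F (pdom p) w) (hw' : fobj F (pdom p') w') :
  @based _ F b -> covering f -> p (b _ w) = p' (b _ w') ->
  exists V (q : 'rV[R]_(pdim p) -> X) (hq : plot V q)
    V' (q' : 'rV[R]_(pdim p') -> X) (hq' : plot V' q'),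
  [/\ q (b _ w) = q' (b _ w'),
    fobj F (pdom (Plot hq)) w, fobj F (pdom (Plot hq')) w',
    V `<=` pdom p /\ (forall s, V s -> f (q s) = p s) &
    V' `<=` pdom p' /\ (forall s, V' s -> f (q' s) = p' s)].
Proof.
move=> bF [ef surj] pp'; have [x fx] := surj (p (b _ w)).
have [V [q [hq [h1 h2 h3 h4]]]] := etale_kan_lift bF ef hw fx.
have fx' : f x = p' (b _ w') by rewrite fx.
have [V' [q' [hq' [h1' h2' h3' h4']]]] := etale_kan_lift bF ef hw' fx'.
by exists V, q, hq, V', q', hq'; split=> //; rewrite h4.
Qed.

Lemma theta_Tk_map k X Y (f : smoothMap X Y) c :
  theta (kan_map f c) = Tk_map k f (theta c).
Proof. by apply: Tk_eq => i; exact: theta_kan_map. Qed.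

Lemma covering_E1 X Y (f : smoothMap X Y) : covering f ->
  elastic_E1 X -> elastic_E1 Y.
Proof.
move=> cf E1 k k0; have [sth [g [sg thK gK]]] := E1 k k0.
have cTk := covering_Tk k0 cf.
have surj t : exists c, @theta R k Y c = t.
  have [t' <-] := cTk.2 t; exists (kan_map f (g t')).
  by rewrite theta_Tk_map gK.
have inj : injective (@theta R k Y).
  elim/(@kan_ind R (Tk_hat k))=> p w hw; elim/(@kan_ind R (Tk_hat k))=> p' w' hw' E.
  (* As [0 < k], [theta] remembers the base point, so both classes can be lifted over one point of
     X. *)
  have pp' : p (lsubmx w) = p' (lsubmx w').
    by rewrite -(tpi_theta hw (Ordinal k0)) E tpi_theta.
  have [V [q [hq [V' [q' [hq' [qq' h h' [VU fq] [VU' fq']]]]]]]] :=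
    covering_kan_lift2 hw hw' (based_Tk k) cf pp'.
  rewrite -(kan_map_lift hw h (based_Tk k) VU fq).
  rewrite -(kan_map_lift hw' h' (based_Tk k) VU' fq').
  congr (kan_map f _); apply: (can_inj thK); apply: Tk_eq => i.
  apply: (etale_tan_inj cf.1); first by rewrite !tpi_theta.
  rewrite -!theta_kan_map (kan_map_lift hw h (based_Tk k) VU fq).
  by rewrite (kan_map_lift hw' h' (based_Tk k) VU' fq') E.
have [h hK] := choice surj.
split; first exact: theta_smooth.
exists h; split; [|by move=> c; apply: inj; rewrite hK|exact: hK].
(* Composed with the covering T_k f, the inverse on Y becomes the smooth inverse [g] on X followed
   by the map induced by [f]. *)
apply: (covering_smooth cTk); have -> : h \o Tk_map k f = kan_map f \o g.
  by apply/funext => t; apply: inj; rewrite /= hK theta_Tk_map gK.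
exact: smooth_comp sg (kan_map_smooth f (based_Tk k)).
Qed.

Lemma covering_E2 X Y (f : smoothMap X Y) : covering f ->
  elastic_E2 X -> elastic_E2 Y.
Proof.
move=> cf [t [st tE]].
(* The formula for the flip must be constant on the fibres of [theta2]. Two representatives with
   equal image on Y have lifts with equal image in T^2 X, where [t] is already a function. *)
have wd p w (hw : fobj T2_hat (pdom p) w) p' w' (hw' : fobj T2_hat (pdom p') w') :
    theta2 (@kan_mk _ _ Y _ _ hw) = theta2 (kan_mk hw') ->
    theta2 (kan_mk (ecompP tau_hat hw)) = theta2 (kan_mk (ecompP tau_hat hw')).
  move=> E; have pp' : p (lsubmx (lsubmx w)) = p' (lsubmx (lsubmx w')).
    by rewrite -(tpi2_theta2 hw) E tpi2_theta2.
  have [V [q [hq [V' [q' [hq' [qq' h h' [VU fq] [VU' fq']]]]]]]] :=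
    covering_kan_lift2 hw hw' based_T2 cf pp'.
  have Eq : theta2 (kan_mk h) = theta2 (kan_mk h').
    apply: (etale_tan2_inj cf.1); first by rewrite !tpi2_theta2.
    rewrite !theta2_kan_map (kan_map_lift hw h based_T2 VU fq).
    by rewrite (kan_map_lift hw' h' based_T2 VU' fq') E.
  have := congr1 (kan_map (Tmap f) \o t) Eq; rewrite /= !tE !theta2_kan_map.
  rewrite (kan_map_lift (ecompP tau_hat hw) (ecompP tau_hat h) based_T2 VU fq).
  by rewrite (kan_map_lift (ecompP tau_hat hw') (ecompP tau_hat h') based_T2 VU' fq').
have /choice[t' ht'] : forall z : Tan (Tan Y), exists z',
    forall p w (hw : fobj T2_hat (pdom p) w), z = theta2 (kan_mk hw) ->
      z' = theta2 (kan_mk (ecompP tau_hat hw)).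
  move=> z; have [c <-] := theta2_surj z; elim/(@kan_ind R T2_hat): c => p w hw.
  by exists (theta2 (kan_mk (ecompP tau_hat hw))) => p' w' hw' /wd.
exists t'; split; last by move=> p w hw; apply: ht'.
apply: (covering_smooth (covering_Tmap (covering_Tmap cf))).
have -> : t' \o Tmap (Tmap f) = kan_map (Tmap f) \o t.
  apply/funext => z /=; have [c <-] := theta2_surj z; elim/(@kan_ind R T2_hat): c => p w hw.
  rewrite tE !theta2_kan_map !kan_mapE.
  exact: (ht' _ (Plot (kan_push_plot f p)) w hw).
exact: smooth_comp st (kan_map_smoothT (Tmap f)).
Qed.

Lemma covering_E3 X Y (f : smoothMap X Y) : covering f ->
  elastic_E3 X -> elastic_E3 Y.
Proof.
move=> cf [linj ls [_ [g [sg gK Kg]]]].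
have lK (a : set_type (range (@lambda R X))) : lambda (g a) = val a.
  by rewrite -[in RHS](Kg a).
have linjY : injective (@lambda R Y).
  move=> a b E; have ab : tpi Y a = tpi Y b by rewrite -(tpi2_lambda a) -(tpi2_lambda b) E.
  have [x fx] := cf.2 (tpi Y a).
  have [a' a'x a'a] := etale_tan_lift cf.1 fx.
  rewrite ab in fx; have [b' b'x b'b] := etale_tan_lift cf.1 fx.
  rewrite -a'a -b'b; congr (kan_map f _); apply: linj.
  apply: (etale_tan2_inj cf.1); first by rewrite !tpi2_lambda a'x b'x.
  by rewrite !lambda_kan_map a'a b'b.
split=> //; first exact: lambda_smooth.
have /choice[h hK] : forall z : set_type (range (@lambda R Y)),
    exists a, lambda a = val z.
  by move=> z; have [a _ az] := set_mem (valP z); exists a.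
split; first by move=> n U p hp; exact: (@lambda_smooth R Y n U p hp).
exists h; split; last first.
- by move=> z; apply: val_inj; exact: hK.
- by move=> a; apply: linjY; rewrite hK.
move=> n U P hP; apply: (plot_local (plot_open hP)) => u Uu.
have [eTT sTT] := covering_Tmap (covering_Tmap cf).
have [z0 fz0] := sTT (val (P u)).
(* The inverse of [lambda] on its image is smooth: a plot of that image is lifted to T^2 X, where
   [g] can be applied. *)
have [V [Q [Vu VU hQ _ fQ]]] := eTT.1 _ _ (fun s => val (P s)) _ _ hP Uu fz0.
(* The lift stays in the image of [lambda]: if [Q s] lies over [lambda a], then a lifts to some a'
   over the base point of [Q s], and [lambda a'] and [Q s] have the same base point and the same
   image. *)
have rQ s : V s -> range (@lambda R X) (Q s).
  move=> Vs; have [a _ aP] := set_mem (valP (P s)).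
  have fx : f (tpi X (tpi _ (Q s))) = tpi Y a.
    have := congr1 (fun z => tpi Y (tpi _ z)) (fQ s Vs).
    by rewrite -[Tmap (Tmap f) _]/(kan_map (Tmap f) _) !tpi_kan_map -aP tpi2_lambda.
  have [a' a'x a'a] := etale_tan_lift cf.1 fx; exists a' => //.
  apply: (etale_tan2_inj cf.1); first by rewrite tpi2_lambda.
  by rewrite lambda_kan_map a'a aP -(fQ s Vs).
pose Q' s : set_type (range (@lambda R X)) := if pselect (V s) is left Vs
  then exist _ (Q s) (mem_set (rQ s Vs)) else exist _ (Q u) (mem_set (rQ u Vu)).
have Q'E s : V s -> val (Q' s) = Q s by rewrite /Q'; case: pselect.
have hQ' : plot V Q'.
  by apply: (plot_eq (p := Q) (q := fun s => val (Q' s))) hQ => s Vs; rewrite Q'E.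
exists V, (kan_map f \o g \o Q'); split=> //.
  exact: (kan_map_smoothT f (sg _ _ _ hQ')).
move=> s Vs /=; apply: linjY; rewrite hK -lambda_kan_map lK Q'E//.
by rewrite -(fQ s Vs).
Qed.

Lemma covering_E4 X Y (f : smoothMap X Y) : covering f ->
  elastic_E4 X -> elastic_E4 Y.
Proof.
move=> cf E4 k k0 z z' E; have cTk := covering_Tk k0 cf.
(* The components of [nu z] lie over those of the base point of z in T_k Y. Both vectors can thus be
   lifted to one fibre over T_k X. *)
have bE : tpi _ z = tpi _ z'.
  by apply: Tk_eq => i; rewrite -!tpi_nu E.
have [t ft] := cTk.2 (tpi _ z).
have [a at_ az] := etale_tan_lift cTk.1 ft.
rewrite bE in ft; have [a' at' az'] := etale_tan_lift cTk.1 ft.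
rewrite -az -az'; congr (kan_map _ _); apply: (E4 k k0).
apply: val_inj; apply: funext => i.
apply: (etale_tan_inj (etale_Tmap cf.1)); first by rewrite !tpi_nu at_ at'.
have fnu (c : Tan (Tk k X)) :
    kan_map (Tmap f) (val (nu c) i) = val (nu (kan_map (Tk_map k f) c)) i.
  pose h := SmoothMap (smooth_comp (@Tk_proj_smooth R k X i) (smooth_funP (Tmap f))).
  rewrite /= (@kan_map_comp _ _ _ _ _ _ _ _ h _ based_T)//.
  by rewrite (@kan_map_comp _ _ _ _ _ _ _ _ h _ based_T).
by rewrite !fnu az az' E.
Qed.

(** Each tangent power of X' is covered by the same tangent power of X, which reduces the iterated
    condition to single spaces. *)
Lemma covering_tangent_power X X' Y (f : smoothMap X X') : covering f ->
  tangent_power X' Y ->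
  exists Y' (g : smoothMap Y' Y), tangent_power X Y' /\ covering g.
Proof.
move=> cf; elim=> {Y} [|Y _ [Y' [g [TY' cg]]]|k Y k0 _ [Y' [g [TY' cg]]]].
- by exists X, f; split=> //; exact: tangent_power0.
- exists (Tan Y'), (Tmap g); split; first exact: tangent_powerT.
  exact: covering_Tmap.
- exists (Tk k Y'), (Tk_map k g); split; first exact: tangent_powerTk.
  exact: covering_Tk.
Qed.

Theorem covering_elastic X Y (f : smoothMap X Y) : covering f ->
  elastic X -> elastic Y.
Proof.
move=> cf EX Z /(covering_tangent_power cf)[Z' [g [/EX[E1 E2 E3 E4] cg]]]; split.
- exact: covering_E1 cg E1.
- exact: covering_E2 cg E2.
- exact: covering_E3 cg E3.
- exact: covering_E4 cg E4.
Qed.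

End Transfer.

(** * Discrete spaces *)

Section Discrete.
Context {R : realType}.
Implicit Types X Y : diffeologicalType R.
Local Notation discrete := (@diffeologically_discrete R).

Lemma discrete_smooth X Y (f : X -> Y) : discrete X -> smooth f.
Proof.
move=> dX n U p hp; apply: (plot_local (plot_open hp)) => u Uu.
have [W [oW Wu Wp]] := near_open (dX _ _ _ hp u Uu).
have oI : open (W `&` U) by apply: openI => //; exact: plot_open hp.
exists (W `&` U), (fun=> f (p u)); split.
- by [].
- by move=> s [].
- exact: plot_cst.
- by move=> s [Ws _] /=; rewrite Wp.
Qed.

(* Along a constant plot every vector is the push-forward of the only vector
   of R^0. *)
Lemma discrete_kan_mk F b X (p p' : parametrization X) w w'
    (hw : fobj F (pdom p) w) (hw' : fobj F (pdom p') w') :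
  @based _ F b -> fdim F 0 = 0%N -> discrete X -> p (b _ w) = p' (b _ w') ->
  kan_mk hw = kan_mk hw'.
Proof.
move=> bF F0 dX.
have h0 : fobj F [set: 'rV[R]_0] 0 by apply/(based_obj bF).
have H (q : parametrization X) v (hv : fobj F (pdom q) v) :
    kan_mk hv = @kan_mk _ F X (Plot (point_plot (q (b _ v)))) 0 h0.
  case: q v hv => n U q hq v hv; have /= Ub := (based_obj bF _ _).1 hv.
  have [W [oW Wu Wq]] := near_open (dX _ _ _ hq _ Ub).
  have oI : open (W `&` U) by apply: openI => //; exact: plot_open hq.
  have hr : plot (W `&` U) q by apply: (plot_sub _ _ hq) => // s [].
  have hvr : fobj F (pdom (Plot hr)) v by apply/(based_obj bF).
  transitivity (kan_mk hvr).
    by apply: kan_mk_dom => //; exact: (based_id bF).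
  apply: (@kan_mk_push _ F X (Plot hr) (Plot (point_plot _)) _ _ hvr h0 (fun=> 0)).
  - exact: smooth_on_cst.
  - by [].
  - by move=> s [/Wq].
  - by apply/matrixP => i j; exfalso; case: j => j /=; rewrite F0.
by move=> E; rewrite (H p) (H p') E.
Qed.

(** A class depends only on its base point, and the base points of a plot of classes locally form a
    plot of X. *)
Lemma discrete_kan F b X : @based _ F b -> fdim F 0 = 0%N -> discrete X ->
  discrete (kan F X).
Proof.
move=> bF F0 dX n U P hP u Uu.
have [V [p [g [hg [Vu VU oV sg Pg]]]]] := kan_plotP hP Uu.
have hp : plot V (p \o (fun s => b _ (g s))).
  apply: (plot_comp (pplot p) oV).
    apply: (smooth_on_comp oV openT _ sg) => //.
    exact/smooth_on_linear/(based_linear bF)/openT.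
  by move=> s Vs; apply/(based_obj bF); exact: (hg s Vs).
have HV : \forall s \near u, V s by apply: open_nbhs_nbhs; split.
apply: filterS2 (dX _ _ _ hp u Vu) HV => s E Vs.
rewrite (Pg s Vs) (Pg u Vu); exact: discrete_kan_mk bF F0 dX E.
Qed.

Lemma discrete_Tan X : discrete X -> discrete (Tan X).
Proof. exact: discrete_kan based_T _. Qed.

Lemma discrete_Tk k X : discrete X -> discrete (Tk k X).
Proof.
move=> dX n U P hP u Uu.
have H i : \forall s \near u, val (P s) i = val (P u) i.
  exact: (discrete_Tan dX (hP.2 i) Uu).
apply: filterS (@filter_forall _ _ (fun i s => val (P s) i = val (P u) i) _ _ H) => s.
exact: Tk_eq.
Qed.

Lemma discrete_sub X (A : set X) : discrete X -> discrete (set_type A).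
Proof.
move=> dX n U P hP u Uu.
by apply: filterS (dX _ _ _ hP u Uu) => s; exact: val_inj.
Qed.

Lemma discrete_tpi_inj X (z z' : Tan X) : discrete X ->
  tpi X z = tpi X z' -> z = z'.
Proof.
move=> dX; elim/(@kan_ind R T_hat): z => p w hw; elim/(@kan_ind R T_hat): z' => p' w' hw'.
rewrite /tpi /= !tpi_mk; exact: discrete_kan_mk based_T _ dX.
Qed.

(** Tangent vectors are determined by their base points, so every equality is a comparison of base
    points. The flip keeps them fixed, hence the identity serves as [tau]. *)
Lemma discrete_elastic_axioms X : discrete X ->
  [/\ elastic_E1 X, elastic_E2 X, elastic_E3 X & elastic_E4 X].
Proof.
move=> dX; split.
- move=> k k0.
  have inj : injective (@theta R k X).
    elim/(@kan_ind R (Tk_hat k))=> p w hw; elim/(@kan_ind R (Tk_hat k))=> p' w' hw' E.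
    apply: (discrete_kan_mk _ _ (based_Tk k)) => //; first by rewrite /= muln0.
    by rewrite -(tpi_theta hw (Ordinal k0)) E tpi_theta.
  have /choice[g gK] : forall t, exists c, @theta R k X c = t.
    move=> t; pose x := tpi X (val t (Ordinal k0)).
    have h0 : fobj (Tk_hat k) [set: 'rV[R]_0] 0 by [].
    exists (@kan_mk _ (Tk_hat k) X (Plot (point_plot x)) 0 h0); apply: Tk_eq => i.
    by apply: discrete_tpi_inj => //; rewrite tpi_theta /=; exact: Tk_tpi.
  split; first exact: theta_smooth.
  exists g; split=> //; first exact: discrete_smooth (discrete_Tk dX).
  by move=> c; apply: inj; rewrite gK.
- exists id; split=> // p w hw; congr theta2.
  apply: (discrete_kan_mk _ _ based_T2) => //.
  by rewrite /= /tau_comp !row_mxKl.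
- have inj : injective (@lambda R X).
    by move=> a b E; apply: discrete_tpi_inj => //; rewrite -(tpi2_lambda a) -(tpi2_lambda b) E.
  split=> //; first exact: lambda_smooth.
  have /choice[h hK] : forall z : set_type (range (@lambda R X)),
      exists a, lambda a = val z.
    by move=> z; have [a _ az] := set_mem (valP z); exists a.
  split; first by move=> n U p hp; exact: (@lambda_smooth R X n U p hp).
  exists h; split.
  + exact/discrete_smooth/discrete_sub/discrete_Tan/discrete_Tan.
  + by move=> a; apply: inj; rewrite hK.
  + by move=> z; apply: val_inj; exact: hK.
- move=> k k0 z z' E; apply: discrete_tpi_inj; first exact: discrete_Tk.
  by apply: Tk_eq => i; rewrite -!tpi_nu E.
Qed.

Theorem discrete_elastic X : discrete X -> elastic X.
Proof.
move=> dX Y TY; apply: discrete_elastic_axioms.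
elim: TY => {Y} [//|Y _|k Y _ _]; first exact: discrete_Tan.
exact: discrete_Tk.
Qed.

End Discrete.

(** * Fibrewise addition, the flip, and brackets of related vector fields *)

Section TangentAddition.
Context {R : realType}.
Implicit Types X Y : diffeologicalType R.

Lemma kan_mk_eq F X (p : parametrization X) w w' (hw : fobj F (pdom p) w)
  (hw' : fobj F (pdom p) w') : w = w' -> @kan_mk R F X p w hw = kan_mk hw'.
Proof. by move=> E; move: hw'; rewrite -E => hw'; rewrite (Prop_irrelevance hw hw'). Qed.

Lemma kan_nat_comp F F' F'' (alpha : enat F F') (beta : enat F' F'')
    (gamma : enat F F'') X (z : kan F X) :
  natural alpha -> natural beta -> natural gamma ->
  (forall n (w : 'rV[R]_(fdim F n)), ecomp beta (ecomp alpha w) = ecomp gamma w) ->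
  kan_nat beta (kan_nat alpha z) = kan_nat gamma z.
Proof.
move=> na nb ng E; elim/(@kan_ind R F): z => p w hw.
by rewrite !kan_natE//; apply: kan_mk_eq; exact: E.
Qed.

Lemma kan_map_id X (f : smoothMap X X) (z : Tan X) : f =1 id -> kan_map f z = z.
Proof.
move=> fE; elim/(@kan_ind R T_hat): z => p w hw; rewrite kan_mapE.
case: p w hw => n U p hp w hw.
by apply: kan_mk_dom => //; [exact: T_mor_id|move=> x _ /=; rewrite fE].
Qed.

Lemma kan_map_tzero X Y (f : smoothMap X Y) x :
  kan_map f (tzero X x) = tzero Y (f x).
Proof.
rewrite /= /tzero_fun kan_mapE; apply: kan_mk_dom => //; exact: T_mor_id.
Qed.

Lemma kan_map_tscale X Y (f : smoothMap X Y) t (z : Tan X) :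
  kan_map f (tscale t z) = tscale t (kan_map f z).
Proof. exact/kan_map_nat/natural_scale. Qed.

Lemma kan_map_sections X Y (f : smoothMap X Y) (g : smoothMap Y X) (z : Tan X) :
  cancel f g -> kan_map g (kan_map f z) = z.
Proof.
move=> fK; pose h := SmoothMap (smooth_comp (smooth_funP f) (smooth_funP g)).
by rewrite (@kan_map_comp _ _ _ _ _ _ _ _ h _ based_T)// kan_map_id.
Qed.

(* (u, v_0, v_1) |-> (u, - v_0, v_0 + v_1): applying + after it recovers v_1,
   which makes + cancellable without knowing that it is associative. *)
Definition shear_comp n (w : 'rV[R]_(n + 2 * n)) : 'rV[R]_(n + 2 * n) :=
  row_mx (lsubmx w) (mxvec (\matrix_(i < 2)
    if i == ord0 then - vec_i ord0 w else vec_i ord0 w + vec_i ord_max w)).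
Lemma shear_compP n (U : set 'rV[R]_n) w :
  fobj (Tk_hat 2) U w -> fobj (Tk_hat 2) U (shear_comp w).
Proof. by rewrite /= row_mxKl. Qed.
Definition shear_hat := @ENat R (Tk_hat 2) (Tk_hat 2) shear_comp shear_compP.

Lemma vec_i_row n (i : 'I_2) (u : 'rV[R]_n) (A : 'M[R]_(2, n)) :
  vec_i i (row_mx u (mxvec A)) = row i A.
Proof. by rewrite /vec_i row_mxKr mxvecK. Qed.

Lemma natural_shear : natural shear_hat.
Proof.
move=> m n U V f w oU oV sf fV Uw.
rewrite /= /shear_comp !row_mxKl; congr (row_mx _ (mxvec _)).
apply/row_matrixP => i; rewrite !rowK !vec_i_row !rowK.
by case: ifP => _; rewrite (linearN, linearD).
Qed.

Section Addition.
Variables (X : diffeologicalType R) (EX : elastic X).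

Lemma elastic_theta_inj : injective (@theta R 2 X).
Proof. by have [_ [g [_ thK _]]] := elastic_has_E1 EX (isT : (0 < 2)%N); exact: can_inj thK. Qed.

(** Any two vectors in one fibre are the components of a single class c, so identities between sums
    become identities of natural transformations on T_2 U. *)
Lemma tadd_theta c :
  tadd EX (val (theta c) ord0) (val (theta c) ord_max) = kan_nat plus_hat c.
Proof.
rewrite /tadd; case: pselect => [ab|[]]; last exact: (Tk_tpi (theta c)).
congr (kan_nat _ _); apply: elastic_theta_inj; rewrite theta2_invK.
apply: Tk_eq => i; rewrite [LHS]/= /pair2.
by case: eqP => [->//|]; case: i => -[|[|//]] // h h'; [exfalso; apply: h'|
  congr (val (theta c) _)]; exact: val_inj.
Qed.

Lemma theta_exists a b : tpi X a = tpi X b ->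
  exists2 c, val (@theta R 2 X c) ord0 = a & val (theta c) ord_max = b.
Proof.
by move=> ab; exists (theta2_inv EX (fib_mk (pair2P ab))); rewrite theta2_invK.
Qed.

Lemma tadd_inj a b b' : tpi X a = tpi X b -> tpi X a = tpi X b' ->
  tadd EX a b = tadd EX a b' -> b = b'.
Proof.
move=> /theta_exists[c ca cb] /theta_exists[c' ca' cb'].
rewrite -[in LHS]ca -cb -[in RHS]ca' -cb' !tadd_theta => E.
have sum d : val (theta (kan_nat shear_hat d)) ord_max = kan_nat plus_hat d :> Tan X.
  apply: (kan_nat_comp (alpha := shear_hat)).
  - exact: natural_shear.
  - exact: natural_proj.
  - exact: natural_plus.
  by move=> n w; rewrite /= /shear_comp row_mxKl vec_i_row rowK.
have opp d : val (theta (kan_nat shear_hat d)) ord0 =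
    tscale (-1) (val (theta d) ord0) :> Tan X.
  rewrite /tscale /=.
  elim/(@kan_ind R (Tk_hat 2)): d => p w hw.
  rewrite (kan_natE _ natural_shear) !(kan_natE _ (natural_proj _)).
  rewrite (kan_natE _ (natural_scale _)); apply: kan_mk_eq.
  by rewrite /= /shear_comp !row_mxKl !row_mxKr vec_i_row rowK scaleN1r.
have snd d : kan_nat plus_hat (kan_nat shear_hat d) = val (theta d) ord_max :> Tan X.
  apply: (kan_nat_comp (alpha := shear_hat)).
  - exact: natural_shear.
  - exact: natural_plus.
  - exact: natural_proj.
  by move=> n w; rewrite /= /shear_comp row_mxKl !vec_i_row !rowK /= addrA addNr add0r.
(* The sheared classes have equal components: [opp] gives -a in both, and [sum] gives the two sums,
   equal by hypothesis. *)
rewrite -!snd; congr (kan_nat _ _); apply: elastic_theta_inj; apply: Tk_eq => i.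
have [->|->] : i = ord0 \/ i = ord_max.
- by case: i => -[|[|//]] h; [left|right]; exact: val_inj.
- by rewrite !opp ca ca'.
- by rewrite !sum.
Qed.

Lemma tauP : is_tau (tau EX).
Proof. by rewrite /tau; case: cid. Qed.

Lemma tau_mk p w (hw : fobj T2_hat (pdom p) w) :
  tau EX (theta2 (kan_mk hw)) = theta2 (kan_mk (ecompP tau_hat hw)).
Proof. exact: tauP.2. Qed.

Lemma theta2_ind (P : Tan (Tan X) -> Prop) :
  (forall p w (hw : fobj T2_hat (pdom p) w), P (theta2 (kan_mk hw))) -> forall z, P z.
Proof. by move=> h z; have [c <-] := theta2_surj z; elim/(@kan_ind R T2_hat): c. Qed.

Lemma tauK : involutive (tau EX).
Proof.
elim/theta2_ind => p w hw; rewrite !tau_mk; congr theta2; apply: kan_mk_eq.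
by rewrite /= /tau_comp !(row_mxKl, row_mxKr) !hsubmxK.
Qed.

(** The flip exchanges the two projections of T^2 X to TX. Since the projection composed with Tp is
    p o [lsubmx], the map [lsubmx] is the required morphism of plots. *)
Lemma tpi_tau z : tpi _ (tau EX z) = kan_map (tpi X) z.
Proof.
elim/theta2_ind: z => p w hw; rewrite tau_mk !theta2_mk kan_mapE.
rewrite -[LHS]/(tpi_fun (kan_mk _)) tpi_mk (T_plotE (ecompP tau_hat hw)).
apply/esym; apply: (@kan_mk_push _ T_hat X (Plot (kan_push_plot (tpi X) (T_plot p)))
  p _ _ hw (ecompP tau_hat hw) lsubmx).
- exact: smooth_on_lsubmx.
- by [].
- by move=> x Ux /=; rewrite -[T_plot_fun _]/(T_plot p x) (T_plotE Ux) tpi_mk.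
rewrite /= /T_mor /tau_comp row_mxKl; congr row_mx.
by rewrite (diff_linear _ (@linear_lsubmx R _ _)).
Qed.

Lemma tpi2_tau z : tpi X (tpi _ (tau EX z)) = tpi X (tpi _ z).
Proof. by rewrite tpi_tau tpi_kan_map. Qed.

Lemma tpi_lambda (a : Tan X) : tpi _ (lambda a) = tzero X (tpi X a).
Proof.
elim/(@kan_ind R T_hat): a => p w hw.
rewrite /lambda (kan_natE _ natural_lambda) theta2_mk.
rewrite -[LHS]/(tpi_fun (kan_mk _)) tpi_mk (T_plotE (ecompP lambda_hat hw)).
rewrite -[tpi X _]/(tpi_fun (kan_mk _)) tpi_mk /=.
have h0 : T_obj (pdom p) (row_mx (lsubmx w) 0) by rewrite /T_obj /= row_mxKl.
by rewrite (tzeroE h0); apply: kan_mk_eq; rewrite /lambda_comp row_mxKl.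
Qed.

Lemma tpi_T0_lambda a b : tpi X a = tpi X b ->
  tpi _ (kan_map (tzero X) a) = tpi _ (lambda b).
Proof. by move=> ab; rewrite tpi_kan_map tpi_lambda ab. Qed.

Lemma tpi2_lambda2 a b : tpi X (tpi _ (lambda2 EX a b)) = tpi X a.
Proof. by rewrite tpi2_tau tpi_tadd tpi_kan_map tpi_tzero. Qed.

End Addition.

Section Brackets.
Variables (X : diffeologicalType R) (EX : elastic X).

Lemma lambda2_inj a b b' : tpi X a = tpi X b -> tpi X a = tpi X b' ->
  lambda2 EX a b = lambda2 EX a b' -> b = b'.
Proof.
move=> /tpi_T0_lambda ab /tpi_T0_lambda ab' /(can_inj (@tauK _ EX)).
move=> /(tadd_inj (EX := elastic_T EX) ab ab').
have [_ _ [linj _ _] _] := EX (tangent_power0 X); exact: linj.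
Qed.

(** Both lie over [w x], the second because the flip turns the base point into the image under
    T(pi), and pi o v is the identity. So the sum in [vf_delta] is never the default value of
    [tadd]. *)
Lemma tpi_delta_summands (v w : vectorField X) x :
  tpi _ (kan_map w (v x)) = tpi _ (tscale (-1) (tau EX (kan_map v (w x)))).
Proof.
rewrite tpi_tscale tpi_tau tpi_kan_map vf_section.
by rewrite (kan_map_sections _ (vf_section v)).
Qed.

Lemma tpi2_delta (v w : vectorField X) x :
  tpi X (tpi _ (vf_delta EX v w x)) = x.
Proof. by rewrite tpi_tadd tpi_kan_map !vf_section. Qed.

End Brackets.

Section Naturality.
Variables (X Y : diffeologicalType R) (EX : elastic X) (EY : elastic Y).
Variable f : smoothMap X Y.

Lemma kan_map_tadd a b : tpi X a = tpi X b ->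
  kan_map f (tadd EX a b) = tadd EY (kan_map f a) (kan_map f b).
Proof.
move=> /(theta_exists EX)[c <- <-]; rewrite tadd_theta -!theta_kan_map tadd_theta.
exact/kan_map_nat/natural_plus.
Qed.

Lemma kan_map_tau z : kan_map (Tmap f) (tau EX z) = tau EY (kan_map (Tmap f) z).
Proof.
elim/theta2_ind: z => p w hw; rewrite tau_mk !theta2_kan_map !kan_mapE.
exact/esym/(@tau_mk _ EY (Plot (kan_push_plot f p))).
Qed.

Lemma kan_map_T0 (a : Tan X) :
  kan_map (Tmap f) (kan_map (tzero X) a) = kan_map (tzero Y) (kan_map f a).
Proof.
pose h := SmoothMap (smooth_comp (smooth_funP (tzero X)) (smooth_funP (Tmap f))).
rewrite (@kan_map_comp _ _ _ _ _ _ _ _ h _ based_T)//.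
rewrite (@kan_map_comp _ _ _ _ _ _ _ _ h _ based_T)// => x.
exact: kan_map_tzero.
Qed.
End Naturality.

Section BracketNaturality.
Variables (X Y : diffeologicalType R) (EX : elastic X) (EY : elastic Y).
Variable f : smoothMap X Y.

Lemma kan_map_lambda2 a b : tpi X a = tpi X b ->
  kan_map (Tmap f) (lambda2 EX a b) = lambda2 EY (kan_map f a) (kan_map f b).
Proof.
move=> ab; rewrite kan_map_tau (kan_map_tadd _ (elastic_T EY)); last exact: tpi_T0_lambda.
by rewrite kan_map_T0 lambda_kan_map.
Qed.

Definition related (v : vectorField X) (v' : vectorField Y) : Prop :=
  forall x, kan_map f (v x) = v' (f x).

Lemma kan_map_field v v' (z : Tan X) : related v v' ->
  kan_map (Tmap f) (kan_map v z) = kan_map v' (kan_map f z).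
Proof.
move=> vv'; pose h := SmoothMap (smooth_comp (smooth_funP v) (smooth_funP (Tmap f))).
rewrite (@kan_map_comp _ _ _ _ _ _ _ _ h _ based_T)//.
by rewrite (@kan_map_comp _ _ _ _ _ _ _ _ h _ based_T)// => x; exact: vv'.
Qed.

Lemma kan_map_delta v w v' w' x : related v v' -> related w w' ->
  kan_map (Tmap f) (vf_delta EX v w x) = vf_delta EY v' w' (f x).
Proof.
move=> vv' ww'; rewrite (kan_map_tadd _ (elastic_T EY)); last exact: tpi_delta_summands.
rewrite (kan_map_field _ ww') vv' kan_map_tscale kan_map_tau.
by rewrite (kan_map_field _ vv') ww'.
Qed.

(** Uniqueness of solutions identifies the field chosen by [xget] with any given solution. *)
Lemma vf_bracket_eq (Z : diffeologicalType R) (EZ : elastic Z) (v w u : vectorField Z) :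
  (forall x, vf_delta EZ v w x = lambda2 EZ (w x) (u x)) ->
  forall x, vf_bracket EZ v w x = u x.
Proof.
move=> uP x; have := xgetPex (vf_zero Z : {classic vectorField Z}).
move=> /(_ [set u | forall x, vf_delta EZ v w x = lambda2 EZ (w x) ((u : vectorField Z) x)]).
move=> /(_ (ex_intro _ u uP))/(_ x); rewrite uP.
by move/lambda2_inj => H; apply/esym/H; rewrite !vf_section.
Qed.

Lemma etale_pullback (u : vectorField Y) : etale f ->
  exists u', related u' u.
Proof.
move=> ef; have /choice[u' hu'] : forall x, exists z, tpi X z = x /\ kan_map f z = u (f x).
  move=> x; have [|z] := @etale_tan_lift _ _ _ f (u (f x)) x ef; last by exists z.
  by rewrite vf_section.
have su' : smooth u'.
  move=> n U p hp; apply: (plot_local (plot_open hp)) => s0 Us0.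
  have hP : plot U (u \o f \o p) by do 2!apply: smooth_funP.
  (* A local lift q of u o f o p through [u' (p s0)] is smooth; its base points agree with p near
     [s0], so there it coincides with u' o p. *)
  have [V [q [Vs VU hq qs fq]]] := (etale_Tmap ef).1 _ _ _ _ _ hP Us0 (hu' (p s0)).2.
  have H : \forall s \near s0, tpi X (q s) = p s.
    apply: (ef.2 _ V (tpi X \o q) p) => //.
    - exact: smooth_funP.
    - by apply: (plot_sub _ _ hp) => //; exact: plot_open hq.
    - move=> s Vs'; rewrite /= -tpi_kan_map.
      by have /(congr1 (tpi Y)) := fq s Vs'; rewrite vf_section.
    - exact: etrans (congr1 (tpi X) qs) (hu' _).1.
  have [W [oW Ws Wq]] := near_open H.
  have oI : open (W `&` V) by apply: openI => //; exact: plot_open hq.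
  exists (W `&` V), q; split.
  - by [].
  - by move=> s [_ /VU].
  - by apply: (plot_sub _ _ hq) => // s [].
  - move=> s [Ws' Vs']; apply: (etale_tan_inj ef).
      exact: etrans (hu' _).1 (esym (Wq s Ws')).
    exact: etrans (hu' _).2 (esym (fq s Vs')).
have h x : tpi X (SmoothMap su' x) = x by exact: (hu' x).1.
by exists (VectorField h) => x; exact: (hu' x).2.
Qed.

(* Existence of the bracket is not needed: its defining equation is solvable on
   X if and only if it is solvable on Y. *)
Lemma covering_bracket v w v' w' x : covering f -> related v v' -> related w w' ->
  kan_map f (vf_bracket EX v w x) = vf_bracket EY v' w' (f x).
Proof.
move=> cf vv' ww'.
have [[u uP]|nY] := pselect (exists u : vectorField Y,
    forall y, vf_delta EY v' w' y = lambda2 EY (w' y) (u y)).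
  have [u' u'u] := etale_pullback u cf.1.
  rewrite (vf_bracket_eq uP) (@vf_bracket_eq _ _ _ _ u') => [|{}x]; first exact: u'u.
  apply: (etale_tan2_inj cf.1); first by rewrite tpi2_delta tpi2_lambda2 vf_section.
  rewrite (kan_map_delta x vv' ww') kan_map_lambda2 ?vf_section//.
  by rewrite ww' u'u.
have nX : ~ exists u : vectorField X,
    forall x, vf_delta EX v w x = lambda2 EX (w x) (u x).
  move=> [u uP]; apply: nY.
  have fu x1 : vf_delta EY v' w' (f x1) = lambda2 EY (w' (f x1)) (kan_map f (u x1)).
    by rewrite -(kan_map_delta x1 vv' ww') uP kan_map_lambda2 ?vf_section// ww'.
  (* At two points of one fibre of [f], the images of u solve the same equation on Y, so they agree
     and u descends. *)
  have /choice[u' hu'] : forall y, exists z, forall x1, f x1 = y -> z = kan_map f (u x1).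
    move=> y; have [x0 fx0] := cf.2 y; exists (kan_map f (u x0)) => x1 fx1.
    apply: (@lambda2_inj _ EY (w' y)).
    - by rewrite tpi_kan_map !vf_section.
    - by rewrite tpi_kan_map !vf_section.
    - by rewrite -{1}fx0 -fu fx0 -fx1 fu.
  have su' : smooth u'.
    apply: (covering_smooth cf); have -> : u' \o f = kan_map f \o u.
      by apply/funext => x1; exact: hu'.
    exact: smooth_comp (smooth_funP u) (kan_map_smoothT f).
  have h y : tpi Y (SmoothMap su' y) = y.
    have [x0 fx0] := cf.2 y.
    by rewrite -[SmoothMap _ _]/(u' y) (hu' _ _ fx0) tpi_kan_map vf_section.
  exists (VectorField h) => y; have [x0 fx0] := cf.2 y.
  by rewrite -[VectorField _ _]/(u' y) (hu' _ _ fx0) -fx0 fu.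
(* With no solution on either side both brackets are the default zero field, and Tf preserves zero
   vectors. *)
rewrite /vf_bracket !xgetPN.
- exact: kan_map_tzero.
- by move=> u uP; apply: nY; exists u.
- by move=> u uP; apply: nX; exists u.
Qed.

End BracketNaturality.
End TangentAddition.

(** * Left-invariant vector fields *)

Section LeftInvariant.
Context {R : realType}.
Variable G : diffeologicalGroupType R.

Lemma plot_mulg n (U : set 'rV[R]_n) (p q : 'rV[R]_n -> G) :
  plot U p -> plot U q -> plot U (fun s => p s * q s)%g.
Proof. by move=> hp hq; exact: (@mulg_smooth R G n U (fun s => (p s, q s))). Qed.

Lemma smooth_left_translate (z : Tan G) :
  smooth (fun g : G => kan_map (lmul g) z : Tan G).
Proof.
elim/(@kan_ind R T_hat): z => p w hw n U r hr.
have oU := plot_open hr; have op := plot_open (pplot p).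
(* All translates of p along r fit into one plot (s,y) |-> r(s) p(y) on D. The translated vector is
   w placed in the second factor, with zero component along s; [i s] is the inclusion of the slice
   at s. *)
pose D : set 'rV[R]_(n + pdim p) := lsubmx @^-1` U `&` rsubmx @^-1` pdom p.
have oD : open D.
  apply: openI.
    by have /continuousP := @continuous_lsubmx R 1 n (pdim p); exact.
  by have /continuousP := @continuous_rsubmx R 1 n (pdim p); exact.
have hD : plot D (fun y => r (lsubmx y) * p (rsubmx y))%g.
  apply: plot_mulg.
  - by apply: (plot_comp hr oD (smooth_on_linear oD (@linear_lsubmx _ _ _))) => y [].
  - by apply: (plot_comp (pplot p) oD (smooth_on_linear oD (@linear_rsubmx _ _ _))) => y [].
pose i (s : 'rV[R]_n) : 'rV[R]_(pdim p) -> 'rV[R]_(n + pdim p) :=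
  cst (row_mx s 0) + row_mx 0.
have iE s v : i s v = row_mx s v by rewrite /i fctE add_row_mx addr0 add0r.
have l0 : linear (row_mx 0 : 'rV[R]_(pdim p) -> 'rV[R]_(n + pdim p)).
  by apply: linear_row_mx => // a x y; rewrite scaler0 addr0.
have di s x : 'd (i s) x = row_mx 0 :> (_ -> _).
  by rewrite /i diff_cstD; [exact: diff_linear|exact: differentiable_linear].
have hg s : U s -> fobj T_hat (pdom (Plot hD))
    (row_mx (row_mx s (lsubmx w)) (row_mx 0 (rsubmx w))).
  by move=> Us; rewrite /= /T_obj /= row_mxKl; split; rewrite /preimage /= ?row_mxKl ?row_mxKr.
apply: (kan_plot (hg := hg) oU).
  apply: smooth_on_row_mx => //; last exact: smooth_on_cst.
  apply: smooth_on_row_mx => //; [exact: smooth_on_id|exact: smooth_on_cst].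
move=> s Us; rewrite [LHS]/= kan_mapE.
apply: (@kan_mk_push _ T_hat G (Plot (kan_push_plot (lmul (r s)) p)) (Plot hD)
  w _ hw (hg s Us) (i s)).
- apply: (smooth_on_eq op (f := fun v => row_mx s v)); first by move=> v _; rewrite iE.
  by apply: smooth_on_row_mx => //; [exact: smooth_on_cst|exact: smooth_on_id].
- by move=> v pv; rewrite iE; split; rewrite /preimage /= ?row_mxKl ?row_mxKr.
- by move=> v pv /=; rewrite iE row_mxKl row_mxKr.
by rewrite /= /T_mor iE di.
Qed.

(** The translates of x form a left-invariant field with value x at the unit, so [xget] does not
    fall back on its default; the field that it picks is determined by its value at the unit. *)
Lemma left_fieldE (x : tangent_space (1%g : G)) g :
  left_field x g = kan_map (lmul g) (val x).
Proof.
have x1 : tpi G (val x) = 1%g := lie_tpi x.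
have vP g' : tpi G (SmoothMap (smooth_left_translate (val x)) g') = g'.
  by rewrite [LHS]tpi_kan_map x1 [LHS]/= mulg1.
have inv : left_invariant (VectorField vP).
  move=> a b; apply/esym; apply: (kan_map_comp _ based_T) => y.
  by rewrite /= mulgA.
have v1 : VectorField vP 1%g = val x by apply: kan_map_id => y; rewrite /= mul1g.
have := xgetPex (vf_zero G : {classic vectorField G}).
move=> /(_ [set v | left_invariant (v : vectorField G) /\ (v : vectorField G) 1%g = val x]).
move=> /(_ (ex_intro _ (VectorField vP) (conj inv v1)))[linv l1].
by have := linv g 1%g; rewrite mulg1 l1.
Qed.

End LeftInvariant.

(** * The isomorphism of Lie algebras induced by a covering homomorphism *)

Section Covering.
Context {R : realType}.
Variables (G K : diffeologicalGroupType R) (f : smoothMap G K).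
Hypotheses (cf : covering f) (fM : forall x y, f (x * y)%g = (f x * f y)%g).
Variables (EG : elastic G) (EK : elastic K).

Let f1 : f 1%g = 1%g.
Proof. by apply: (@mulIg _ (f 1%g)); rewrite -fM !mul1g. Qed.

Lemma lie_map_subproof (x : lieAlgebra EG) : tpi K (kan_map f (val x)) = 1%g.
Proof. by rewrite tpi_kan_map lie_tpi f1. Qed.
Definition lie_map (x : lieAlgebra EG) : lieAlgebra EK := lie_mk (lie_map_subproof x).

Lemma lie_map_bij : bijective lie_map.
Proof.
have inj : injective lie_map.
  move=> x y /(congr1 val) /= E; apply: val_inj.
  by apply: (etale_tan_inj cf.1) => //; rewrite !lie_tpi.
have /choice[g gK] : forall y, exists x, lie_map x = y.
  move=> y; have [|z z1 zy] := @etale_tan_lift _ _ _ f (val y) 1%g cf.1.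
    by rewrite f1 lie_tpi.
  by exists (lie_mk z1); apply: val_inj.
by exists g => // x; apply: inj; rewrite gK.
Qed.

(** As [f] is a homomorphism, [f] o (left translation by g) = (left translation by [f g]) o [f]; now
    apply T. *)
Lemma left_field_related (x : lieAlgebra EG) :
  related f (left_field x) (left_field (lie_map x)).
Proof.
move=> g; rewrite !left_fieldE [val (lie_map x)]/=.
pose h := SmoothMap (smooth_comp (smooth_funP f) (smooth_funP (lmul (f g)))).
rewrite (@kan_map_comp _ _ _ _ _ _ _ _ h _ based_T); last first.
  by move=> y; apply/esym; exact: fM.
by rewrite (@kan_map_comp _ _ _ _ _ _ _ _ h _ based_T).
Qed.

Theorem covering_lie : lie_isomorphic (lieAlgebra EK) (lieAlgebra EG).
Proof.
have [g fK gK] := lie_map_bij.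
(* The isomorphism runs from K to G, so it is the inverse of T_e f. Each operation is compared
   through [lie_map] and carried over by [canLR]. *)
exists g; split=> [|x y|t x|x y]; first by exists lie_map.
- rewrite -{1}[x]gK -{1}[y]gK; apply: (canLR fK); apply: val_inj => /=.
  by rewrite (kan_map_tadd _ EK)// !lie_tpi.
- rewrite -{1}[x]gK; apply: (canLR fK); apply: val_inj => /=.
  by rewrite kan_map_tscale.
- rewrite -{1}[x]gK -{1}[y]gK; apply: (canLR fK); apply: val_inj => /=.
  by rewrite (covering_bracket _ EK _ cf (left_field_related _) (left_field_related _)) f1.
Qed.

End Covering.

(** * The quotient map by a discrete normal subgroup is a covering *)

Section Quotient.
Context {R : realType} (G : diffeologicalGroupType R) (H : normalSubgroup G).
Local Notation cl := (dpi (coset_rel H)).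
Local Open Scope group_scope.

Lemma quotient_map_smooth : smooth (fun x : G => cl x : quotient_group H).
Proof.
move=> n U p hp; split; first exact: plot_open hp.
by move=> u Uu; exists U, p; split.
Qed.
Definition quotient_map : smoothMap G (quotient_group H) := SmoothMap quotient_map_smooth.

Lemma quotient_covering : diffeologically_discrete (set_type H) -> covering quotient_map.
Proof.
move=> dH; split; last first.
  by move=> y; exists (drepr (y : dquot (coset_rel H))); exact: dreprK.
split=> [n U p u x [_ hp] Uu /esym pu|n U p q u hp hq Uu pq pqu].
  have [V [q [Vu VU hq pq]]] := hp u Uu.
  (* Any local lift q can be moved to pass through x by right translation with this element of H. *)
  have hx : nsub_set H ((q u)^-1 * x) by apply/cosetP; rewrite -pq.
  exists V, (fun s => q s * ((q u)^-1 * x)); split=> //.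
  - by apply: plot_mulg => //; apply: plot_cst; exact: plot_open hq.
  - by rewrite mulgA mulgV mul1g.
  - move=> s Vs; rewrite pq//; apply/cosetP; rewrite /coset_rel invgM -mulgA mulVg mulg1.
    exact: nsubV.
(* Two lifts differ by a plot with values in H. By discreteness it is constant near u, and its value
   at u is 1. *)
have hr : plot U (fun s => (p s)^-1 * q s).
  by apply: plot_mulg => //; exact: (@invg_smooth R G n U p).
have rH s : U s -> nsub_set H ((p s)^-1 * q s) by move=> /pq/cosetP.
pose r s : set_type H := if pselect (nsub_set H ((p s)^-1 * q s)) is left h
  then exist (fun y => y \in nsub_set H) _ (mem_set h)
  else exist (fun y => y \in nsub_set H) _ (mem_set (nsub1 H)).
have rE s : U s -> val (r s) = (p s)^-1 * q s.
  by move=> /rH h; rewrite /r; case: pselect.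
have pr : plot U r.
  by apply: (plot_eq (q := fun s => val (r s))) hr => s Us; rewrite rE.
have HU : \forall s \near u, U s.
  by apply: open_nbhs_nbhs; split=> //; exact: plot_open hp.
apply: filterS2 (dH _ _ _ pr u Uu) HU => s /(congr1 val) E Us.
move: E; rewrite !rE// pqu mulVg => E.
by rewrite -[LHS]mulg1 -E mulgA mulgV mul1g.
Qed.

End Quotient.

Theorem corollary3p25 (R : realType) (G : diffeologicalGroupType R)
    (H : normalSubgroup G) (EG : elastic G) :
  diffeologically_discrete (set_type H) ->
  elastic (set_type H) /\
  exists EQ : elastic (quotient_group H),
    lie_isomorphic (lieAlgebra EQ) (lieAlgebra EG).
Proof.
move=> dH; split; first exact: discrete_elastic.
have cq := quotient_covering dH.
exists (covering_elastic cq EG).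
by apply: (covering_lie cq) => x y; apply/esym; exact: qmulE.
Qed.
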